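(* Let $r\geq 4$ be an integer. If a (finite, simple) graph $G$ has minimum degree $\delta(G)\geq (1-1/(100r))|G|$, then $G$ has a fractional $K_r$-decomposition.
   Context: $|G|$ denotes the number of vertices of $G$ and $K_r$ the complete graph on $r$ vertices. For a graph $F$, a graph $G$ has a fractional $F$-decomposition if, letting $\mathcal{F}(G)$ be the set of all copies of $F$ in $G$ (subgraphs of $G$ isomorphic to $F$), there is a function $\omega:\mathcal{F}(G)\to[0,1]$ such that for every edge $e\in E(G)$, $\sum_{F'\in\mathcal{F}(G):\,e\in E(F')}\omega(F')=1$. *)

(* Defs.v *)
From mathcomp Require Import all_boot all_order all_algebra reals.

Set Implicit Arguments.
Unset Strict Implicit.
Unset Printing Implicit Defensive.

Import Order.TTheory GRing.Theory Num.Theory.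
Local Open Scope ring_scope.

Record sgraph := SGraph {
  vertex :> finType;
  adj : rel vertex;
  adj_sym : symmetric adj;
  adj_irr : irreflexive adj }.

Definition edges (G : sgraph) : {set {set G}} :=
  [set [set p.1; p.2] | p in [set p : G * G | adj p.1 p.2]].

Definition degree (G : sgraph) (x : G) : nat := #|[set y | adj x y]|.

(* Every degree is at most #|G|, so the default value #|G| only matters for the
   graph without vertices, whose minimum degree is 0 here. *)
Definition min_degree (G : sgraph) : nat :=
  \big[minn/#|G|]_(x : G) degree x.

Definition complete_adj (r : nat) : rel 'I_r := fun x y => x != y.

Lemma complete_adj_sym r : symmetric (@complete_adj r).
Proof. by move=> x y; rewrite /complete_adj eq_sym. Qed.

Lemma complete_adj_irr r : irreflexive (@complete_adj r).
Proof. by move=> x; rewrite /complete_adj eqxx. Qed.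

Definition complete_graph (r : nat) : sgraph :=
  SGraph (@complete_adj_sym r) (@complete_adj_irr r).

Definition pregraph (G : sgraph) : finType :=
  ({set G} * {set {set G}})%type.

Definition is_subgraph (G : sgraph) (H : pregraph G) : bool :=
  (H.2 \subset edges G) && [forall e in H.2, e \subset H.1].

Definition isomorphic_to (F G : sgraph) (H : pregraph G) : bool :=
  [exists f : {ffun F -> G},
    [&& injectiveb f, f @: [set: F] == H.1
      & [forall x, forall y, adj x y == ([set f x; f y] \in H.2)]]].

Definition copies (F G : sgraph) : {set pregraph G} :=
  [set H | is_subgraph H && isomorphic_to F H].

(* Only the values of w on copies F G are relevant. *)
Definition fractional_decomposition (R : realType) (F G : sgraph) : Prop :=
  exists w : pregraph G -> R,
    (forall H, H \in copies F G -> 0 <= w H <= 1) /\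
    (forall e, e \in edges G ->
       \sum_(H in copies F G | e \in H.2) w H = 1).

(* Main.v *)
(** A fractional K_r-decomposition is a measure on the r-cliques of G all of
whose edge marginals are equal.  Consider the Gibbs measures giving an r-clique
S the weight exp(sum_{x in S} b x + sum_{xy in S} f x y).  If f <= 0 the
measure is a repulsive gas: counting a non-edge as interaction 1, the total
interaction of a vertex is O(n/r) with a small constant, so conditioning on a
vertex u changes vertex probabilities by bounded factors R(u), and the edge
marginal factors as e^(b u + b v + f u v) R(u) R(v) Q(u,v) with Q(u,v) - 1
bounded by a multiple of (r/n) (M^2)(u,v), where M majorises the interaction.
Hence, given target marginals T, the parameters b', f' that would correct all
marginals at once lie again in the box of admissible parameters.  Minimising
the convex function sum_S exp(energy(S) - sum_e T(e) F(e)) on that box and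
testing the minimiser in the direction of (b', f') gives
sum_e (A(e) - Z T(e)) log (A(e) / T(e)) <= 0 up to normalisation, so the
marginals A are exactly proportional to T.

Keeping f' <= 0 requires targets slightly below the uniform one,
T(u,v) ~ 1 - c (r/n) (M^2)(u,v).  They are obtained by a mixture: for a random
tuple w of ghost vertices put s_w(u) = prod_i (1 - M(u, w_i) / 2), whose
covariance is positive of order (r/n) M^2, and solve for the targets
s_w(u) s_w(v) / E[s(u) s(v)].  Averaging the solutions over w makes every edge
marginal equal to 1. *)

Require Import Defs.
From mathcomp Require Import all_boot all_order all_algebra reals.
From mathcomp Require Import all_classical all_analysis.
(* finset comes last so that its names prevail over those of classical_sets *)
From mathcomp Require Import finset ring lra.

Set Implicit Arguments.
Unset Strict Implicit.
Unset Printing Implicit Defensive.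

Import Order.TTheory GRing.Theory Num.Theory.
Import numFieldNormedType.Exports.
Local Open Scope ring_scope.

Lemma bernoulli (R : realFieldType) (x : R) k : -1 <= x -> 1 + k%:R * x <= (1 + x) ^+ k.
Proof.
move=> x1; elim: k => [|k IH]; first by rewrite expr0 mul0r addr0.
rewrite exprS; apply: le_trans (_ : (1 + x) * (1 + k%:R * x) <= _); last first.
  by rewrite ler_wpM2l //; lra.
have k0 : 0 <= k%:R :> R by [].
rewrite -natr1; have := mulr_ge0 k0 (sqr_ge0 x); rewrite expr2; lra.
Qed.

(** * Repulsive partition functions *)

Section Gibbs.
Context {R : realFieldType} {V : finType}.
Implicit Types (phi M : V -> V -> R) (h : V -> R).

Definition tilt phi h (x : V) : V -> R := fun y => h y * phi x y.

(** The partition function of [k] labelled points with activity [h] and pair interaction [phi]. The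
    recursion places one point and absorbs the interaction with it into the activity of the others,
    so conditioning on a point is again a tilt. *)
Fixpoint Zpart phi (k : nat) h : R :=
  if k is k'.+1 then \sum_x h x * Zpart phi k' (tilt phi h x) else 1.

Lemma eq_Zpart phi k h1 h2 : h1 =1 h2 -> Zpart phi k h1 = Zpart phi k h2.
Proof.
elim: k h1 h2 => [//|k IH] h1 h2 h12 /=.
apply: eq_bigr => x _; rewrite h12; congr (_ * _).
by apply: IH => y; rewrite /tilt h12.
Qed.

Lemma Zpart_tiltC phi k h x y :
  Zpart phi k (tilt phi (tilt phi h x) y) = Zpart phi k (tilt phi (tilt phi h y) x).
Proof. by apply: eq_Zpart => z; rewrite /tilt mulrAC. Qed.

Lemma one_subX (x : R) k : x <= 1 -> 1 - k%:R * x <= (1 - x) ^+ k.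
Proof. by move=> x1; rewrite -mulrN; apply: bernoulli; lra. Qed.

Lemma one_addX (x : R) k : 0 <= x -> k%:R * x < 1 ->
  (1 + x) ^+ k * (1 - k%:R * x) <= 1.
Proof.
move=> x0; elim: k => [|k IH]; first by rewrite expr0 mul0r subr0 mul1r.
rewrite -natr1 => kx1; have k0 : 0 <= k%:R :> R by [].
have {}IH := IH ltac:(lra).
apply: le_trans IH; rewrite exprSr -mulrA ler_wpM2l ?exprn_ge0 ?addr_ge0 //.
have := mulr_ge0 k0 (mulr_ge0 x0 x0); have := mulr_ge0 x0 x0; lra.
Qed.

Section Estimates.
Variables (phi M : V -> V -> R) (r : nat).
Let n : R := #|V|%:R.
Hypothesis r4 : (4 <= r)%N.
Hypothesis n0 : 0 < n.
Hypothesis M0 : forall x y, 0 <= M x y.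
Hypothesis Mrow : forall x, \sum_y M x y <= n / (60 * r%:R).
Hypothesis phi0 : forall x y, 0 <= phi x y.
Hypothesis phi1 : forall x y, phi x y <= 1.
Hypothesis phiM : forall x y, 1 - phi x y <= M x y.

Let r0 : 0 < r%:R :> R. Proof. by rewrite ltr0n; case: r r4. Qed.
Let r4R : 4 <= r%:R :> R. Proof. by rewrite ler_nat. Qed.

Let n43 : 0 <= 4 / 3 / n.
Proof. by apply: divr_ge0; [lra | exact: ltW]. Qed.

(* 25/22 = (45/44)(10/9) is the largest vertex weight e^b that will occur, 9/10
   the least mean weight, and each tilt costs at most (25/22) n/(60 r) of it. *)
Definition spread (j : nat) h : Prop :=
  (forall x, 0 <= h x <= 25 / 22) /\
  n * (9 / 10 - j%:R * (5 / 264 / r%:R)) <= \sum_x h x.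

Lemma spread_tilt j h x : spread j h -> spread j.+1 (tilt phi h x).
Proof.
move=> [h01 hs]; split.
  move=> y; rewrite /tilt; have /andP[h0 h1] := h01 y.
  rewrite mulr_ge0 //=; apply: le_trans h1.
  by rewrite ler_piMr.
have : \sum_y h y - \sum_y tilt phi h x y <= 25 / 22 * \sum_y M x y.
  rewrite -sumrB mulr_sumr ler_sum // => y _; rewrite /tilt.
  have /andP[h0 h1] := h01 y.
  apply: le_trans (_ : h y * M x y <= _); last by rewrite ler_wpM2r.
  by rewrite -{1}(mulr1 (h y)) -mulrBr ler_wpM2l.
have := Mrow x; rewrite invfM mulrCA => Mr.
have -> : n * (9 / 10 - j.+1%:R * (5 / 264 / r%:R)) =
   n * (9 / 10 - j%:R * (5 / 264 / r%:R)) - 25 / 22 * (60^-1 * (n / r%:R)).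
  rewrite -natr1; field; by rewrite gt_eqF.
by lra.
Qed.

Lemma spread_sum j h : (j <= r)%N -> spread j h -> n * (9 / 10 - 5 / 264) <= \sum_x h x.
Proof.
move=> jr [_]; apply: le_trans; rewrite ler_pM2l //.
have jr' : j%:R / r%:R <= 1 :> R by rewrite ler_pdivrMr // mul1r ler_nat.
have -> : j%:R * (5 / 264 / r%:R) = 5 / 264 * (j%:R / r%:R) :> R by ring.
by lra.
Qed.

Lemma Zpart_ge0 k h : (forall x, 0 <= h x) -> 0 <= Zpart phi k h.
Proof.
elim: k h => [|k IH] h h0 /=; first exact: ler01.
apply: sumr_ge0 => x _; rewrite mulr_ge0 // IH // => y.
by rewrite mulr_ge0.
Qed.

Lemma le_Zpart k h1 h2 : (forall x, 0 <= h1 x <= h2 x) ->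
  Zpart phi k h1 <= Zpart phi k h2.
Proof.
elim: k h1 h2 => [|k IH] h1 h2 h12 //=.
apply: ler_sum => x _; have /andP[h1p h12x] := h12 x.
rewrite ler_pM //.
- by apply: Zpart_ge0 => y; rewrite mulr_ge0 //; have /andP[] := h12 y.
- apply: IH => y; have /andP[h1y h12y] := h12 y.
  by rewrite /tilt mulr_ge0 //= ler_wpM2r.
Qed.

Lemma Zpart_tilt_le k h x : (forall x, 0 <= h x) ->
  Zpart phi k (tilt phi h x) <= Zpart phi k h.
Proof.
by move=> h0; apply: le_Zpart => y; rewrite /tilt mulr_ge0 //= ler_piMr.
Qed.

(** A placed point sits at any given [y] with relative weight at most (4/3)/n, and row sums of [M]
    are at most n/(60 r). So a tilt costs each point at most the fraction (4/3)/(60 r) = 1/(45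
    r). *)
Let d : R := (45 * r%:R)^-1.
Let d1 : d <= 1 / 180.
Proof. rewrite /d mul1r lef_pV2 ?posrE ?mulr_gt0 //; have := r4R; lra. Qed.

Lemma loss_ge k : (k <= r)%N -> 44 / 45 <= (1 - d) ^+ k.
Proof.
move=> kr; apply: le_trans (one_subX k _); last by have := d1; lra.
have jr' : k%:R / r%:R <= 1 :> R by rewrite ler_pdivrMr // mul1r ler_nat.
have -> : k%:R * d = 45^-1 * (k%:R / r%:R).
  by rewrite /d; field; rewrite gt_eqF.
by lra.
Qed.

(** The first point is almost uniform. The last two hypotheses are what [Zpart_tilt] gives for [k]
    points; they bound the total below by n (9/10 - 5/264)(44/45) [Zpart phi k h], one term is at
    most (25/22) [Zpart phi k h], and the quotient is below (4/3)/n. *)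
Lemma Zpart_step j k h : spread j h -> (j + k < r)%N -> 0 < Zpart phi k h ->
  (forall y, (1 - d) ^+ k * Zpart phi k h <= Zpart phi k (tilt phi h y)) ->
  0 < Zpart phi k.+1 h /\
  (forall y, 0 <= h y * Zpart phi k (tilt phi h y) <= 4 / 3 / n * Zpart phi k.+1 h).
Proof.
move=> hh jk Z0 Zt.
have Zlow : n * (9 / 10 - 5 / 264) * (44 / 45 * Zpart phi k h) <= Zpart phi k.+1 h.
  apply: le_trans (_ : (\sum_x h x) * (44 / 45 * Zpart phi k h) <= _).
    rewrite ler_wpM2r //; first by have := ltW Z0; lra.
    by apply: spread_sum hh; apply: leq_trans (leq_addr _ _) (ltnW jk).
  rewrite /= mulr_suml ler_sum // => x _; have [/(_ x)/andP[h0 _] _] := hh.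
  rewrite ler_wpM2l //; apply: le_trans (Zt x).
  rewrite ler_wpM2r ?(ltW Z0) // loss_ge //.
  by apply: leq_trans (ltnW jk); exact: leq_addl.
have nZ : 0 < n * Zpart phi k h by rewrite mulr_gt0.
have Zpos : 0 < Zpart phi k.+1 h by apply: lt_le_trans Zlow; lra.
split=> // y; have [h01 _] := hh; have /andP[h0 h1] := h01 y.
have hp x : 0 <= h x by have /andP[] := h01 x.
have -> : 4 / 3 / n * Zpart phi k.+1 h = 4 / 3 * (Zpart phi k.+1 h / n) by ring.
apply/andP; split.
  by rewrite mulr_ge0 // Zpart_ge0 // => z; rewrite mulr_ge0.
apply: le_trans (_ : 25 / 22 * Zpart phi k h <= _).
  apply: ler_pM => //; last exact: Zpart_tilt_le.
  by apply: Zpart_ge0 => z; rewrite mulr_ge0.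
rewrite mulrA ler_pdivlMr //; lra.
Qed.

(** Induction on [k]: summed over the first point [y], the factors [phi x y] cost 1 - d by
    [Zpart_step]; the other points cost (1 - d)^k by induction applied to the activity tilted by
    [y], which is why [j] must vary. *)
Lemma Zpart_tilt k j h : spread j h -> (j + k <= r)%N ->
  0 < Zpart phi k h /\
  (forall x, (1 - d) ^+ k * Zpart phi k h <= Zpart phi k (tilt phi h x)).
Proof.
elim: k j h => [|k IH] j h hh jk.
  by rewrite ltr01; split=> // x; rewrite expr0 mul1r.
have [Z0 Zt] := IH _ _ hh ltac:(by apply: leq_trans jk; rewrite addnS leqnSn).
have jk' : (j + k < r)%N by rewrite -addnS.
have [Zp Zw] := Zpart_step hh jk' Z0 Zt; split=> // x.
have [h01 _] := hh.
have hp y : 0 <= h y by have /andP[] := h01 y.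
have dk0 : 0 <= (1 - d) ^+ k by rewrite exprn_ge0 //; have := d1; lra.
apply: le_trans (_ : (1 - d) ^+ k * \sum_y (h y * phi x y) * Zpart phi k (tilt phi h y) <= _).
  rewrite exprSr -mulrA ler_wpM2l //.
  have -> : (1 - d) * Zpart phi k.+1 h = Zpart phi k.+1 h - d * Zpart phi k.+1 h by ring.
  rewrite lerBlDr -lerBlDl /= -sumrB.
  apply: le_trans (_ : \sum_y (4 / 3 / n * Zpart phi k.+1 h) * M x y <= _).
    apply: ler_sum => y _; have /andP[w0 w1] := Zw y.
    rewrite (_ : _ - _ = h y * Zpart phi k (tilt phi h y) * (1 - phi x y)); last by ring.
    by apply: le_trans (_ : _ <= h y * Zpart phi k (tilt phi h y) * M x y) _;
       [rewrite ler_wpM2l | rewrite ler_wpM2r].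
  rewrite -mulr_sumr; apply: le_trans (_ : 4 / 3 / n * Zpart phi k.+1 h * (n / (60 * r%:R)) <= _).
    by apply: ler_wpM2l => //; exact: mulr_ge0 n43 (ltW Zp).
  rewrite le_eqVlt; apply/orP; left; apply/eqP; rewrite /d /=; field.
  by rewrite !gt_eqF.
rewrite /= mulr_sumr ler_sum // => y _; rewrite mulrCA ler_wpM2l ?mulr_ge0 //.
rewrite Zpart_tiltC.
have jk1 : (j.+1 + k <= r)%N by rewrite addSn.
by have [_] := IH _ _ (spread_tilt y hh) jk1; apply.
Qed.

Lemma Zpart_gt0 k j h : spread j h -> (j + k <= r)%N -> 0 < Zpart phi k h.
Proof. by move=> hh jk; have [] := Zpart_tilt hh jk. Qed.

Lemma Zpart_tilt_ge k j h x : spread j h -> (j + k <= r)%N ->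
  44 / 45 * Zpart phi k h <= Zpart phi k (tilt phi h x).
Proof.
move=> hh jk; have [Z0 /(_ x)] := Zpart_tilt hh jk; apply: le_trans.
rewrite ler_wpM2r ?(ltW Z0) // loss_ge //; exact: leq_trans (leq_addl _ _) jk.
Qed.

(** * Correlation between conditioning on two vertices *)

Let G2 u v : R := r%:R / n * \sum_z M u z * M v z.
(** Bounds the covariance of two conditionings: the [G2] term pays for the mean of a product, the
    constant for the product of the means. *)
Let Mp u v : R := 9 * G2 u v + (250 * r%:R)^-1.
Hypothesis MpM : forall u v, Mp u v <= M u v.
Hypothesis G2_le : forall u v, G2 u v <= 1 / 50.

Let G2_ge0 u v : 0 <= G2 u v.
Proof.
rewrite mulr_ge0 ?divr_ge0 ?(ltW n0) ?(ltW r0) // sumr_ge0 // => z _.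
exact: mulr_ge0.
Qed.

Let Mp_ge0 u v : 0 <= Mp u v.
Proof.
have : 0 <= (250 * r%:R)^-1 :> R by rewrite invr_ge0 mulr_ge0 // ltW.
by rewrite /Mp; have := G2_ge0 u v; lra.
Qed.

Let ri_le : r%:R^-1 <= 1 / 4 :> R.
Proof. by rewrite mul1r lef_pV2 ?posrE. Qed.

Let ri_gt0 : 0 < r%:R^-1 :> R. Proof. by rewrite invr_gt0. Qed.

Let Mp_le u v : Mp u v <= 181 / 1000.
Proof. rewrite /Mp invfM; have := G2_le u v; have := ri_le; lra. Qed.

(** The constant is 13/450 = (4/3)(13/10)/60. In the factor 13/10, the interaction itself
    contributes 1 and the correlation error 3/10. *)
Lemma weighted_sum_bound (w a : V -> R) u :
  0 < \sum_y w y -> (forall y, 0 <= w y <= 4 / 3 / n * \sum_y w y) ->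
  (forall y, `|a y| <= 13 / 10 * M u y) ->
  `|\sum_y w y * a y| <= 13 / 450 * r%:R^-1 * \sum_y w y.
Proof.
move=> S0 hw ha; apply: le_trans (ler_norm_sum _ _ _) _.
apply: le_trans (_ : \sum_y (4 / 3 / n * \sum_y w y) * (13 / 10 * M u y) <= _).
  apply: ler_sum => y _; have /andP[w0 w1] := hw y.
  by rewrite normrM (ger0_norm w0) ler_pM.
rewrite -mulr_sumr -mulr_sumr.
apply: le_trans (_ : _ <= 4 / 3 / n * (\sum_y w y) * (13 / 10 * (n / (60 * r%:R)))) _.
  by apply: ler_wpM2l; [exact: mulr_ge0 n43 (ltW S0) | have := Mrow u; lra].
rewrite le_eqVlt; apply/orP; left; apply/eqP; field.
by rewrite !gt_eqF.
Qed.

(** For the probability weights proportional to [w], this bounds Cov(a, b) relative to E(1 + a) E(1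
    + b). Here E|ab| is at most (4/3)(13/10)^2 [G2]/r and |E a E b| at most (13/(450 r))^2. *)
Lemma covariance_bound (w a b : V -> R) u v :
  0 < \sum_y w y -> (forall y, 0 <= w y <= 4 / 3 / n * \sum_y w y) ->
  (forall y, `|a y| <= 13 / 10 * M u y) ->
  (forall y, `|b y| <= 13 / 10 * M v y) ->
  (1 - 7 / 25 / r%:R * Mp u v) *
    ((\sum_y w y * (1 + a y)) * (\sum_y w y * (1 + b y)))
  <= (\sum_y w y * ((1 + a y) * (1 + b y))) * (\sum_y w y)
  <= (1 + 7 / 25 / r%:R * Mp u v) *
    ((\sum_y w y * (1 + a y)) * (\sum_y w y * (1 + b y))).
Proof.
move=> S0 hw ha hb; set x := _ * Mp u v.
set sa := \sum_y w y * (1 + a y); set sb := \sum_y w y * (1 + b y).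
set sab := \sum_y w y * (_ * _).
have := weighted_sum_bound S0 hw ha; have := weighted_sum_bound S0 hw hb.
have : `|\sum_y w y * (a y * b y)| <= 169 / 75 * (r%:R^-1 * G2 u v) * \sum_y w y.
  apply: le_trans (ler_norm_sum _ _ _) _.
  apply: le_trans (_ : \sum_y (4 / 3 / n * \sum_y w y) * (169 / 100 * (M u y * M v y)) <= _).
    apply: ler_sum => y _; have /andP[w0 w1] := hw y.
    rewrite normrM (ger0_norm w0) ler_pM // normrM.
    have -> : 169 / 100 * (M u y * M v y) = (13 / 10 * M u y) * (13 / 10 * M v y) by field.
    by rewrite ler_pM.
  rewrite -mulr_sumr -mulr_sumr le_eqVlt; apply/orP; left; apply/eqP; rewrite /G2; field.
  by rewrite !gt_eqF.
have -> : sa = \sum_y w y + \sum_y w y * a y.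
  by rewrite -big_split; apply: eq_bigr => y _ /=; rewrite mulrDr mulr1.
have -> : sb = \sum_y w y + \sum_y w y * b y.
  by rewrite -big_split; apply: eq_bigr => y _ /=; rewrite mulrDr mulr1.
have -> : sab = \sum_y w y + \sum_y w y * a y + \sum_y w y * b y + \sum_y w y * (a y * b y).
  by rewrite -!big_split; apply: eq_bigr => y _ /=; ring.
move: S0; set S := \sum_y w y; set A := \sum_y _ * a y; set B := \sum_y _ * b y.
set C := \sum_y _ => S0.
rewrite !ler_norml => /andP[C1 C2] /andP[B1 B2] /andP[A1 A2].
set t := r%:R^-1 in x C1 C2 A1 A2 B1 B2 *.
have t0 : 0 < t by []. have t1 : t <= 1 / 4 by [].
set g := G2 u v in C1 C2.
have g0 : 0 <= g by exact: G2_ge0.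
have xE : x = 7 / 25 * t * (9 * g + t / 250) by rewrite /x /Mp invfM /t /g; ring.
have [E e0 e1] : exists2 E, E = 13 / 450 * t & 0 <= E <= 13 / 1800.
  by exists (13 / 450 * t) => //; lra.
rewrite -e0 in A1 A2 B1 B2.
have SE : 0 <= E * S <= 13 / 1800 * S.
  case/andP: e1 => e1 e2; by rewrite mulr_ge0 ?(ltW S0) //= ler_wpM2r ?(ltW S0).
(* |S C - A B| <= S^2 (169/75 t g + E^2), while (S+A)(S+B) >= S^2 (1-E)^2 *)
have SC : `|S * C| <= 169 / 75 * (t * g) * (S * S).
  have -> : 169 / 75 * (t * g) * (S * S) = S * (169 / 75 * (t * g) * S) by ring.
  by rewrite normrM (gtr0_norm S0) ler_wpM2l ?(ltW S0) // ler_norml C1.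
have AB : `|A * B| <= E ^+ 2 * (S * S).
  have -> : E ^+ 2 * (S * S) = (E * S) * (E * S) by ring.
  by rewrite normrM ler_pM // ler_norml ?A1 ?B1.
have SAB : (1 - 13 / 1800) ^+ 2 * (S * S) <= (S + A) * (S + B).
  have -> : (1 - 13 / 1800) ^+ 2 * (S * S) = ((1 - 13 / 1800) * S) * ((1 - 13 / 1800) * S).
    by ring.
  by case/andP: SE => *; apply: ler_pM; lra.
have key : `|S * C - A * B| <= x * ((S + A) * (S + B)).
  apply: le_trans (ler_normB _ _) _.
  apply: le_trans (lerD SC AB) _; rewrite -mulrDl.
  have x0 : 0 <= x.
    by rewrite xE; apply: mulr_ge0; lra.
  apply: le_trans (_ : _ <= x * ((1 - 13 / 1800) ^+ 2 * (S * S))) _; last by rewrite ler_wpM2l.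
  rewrite [leRHS]mulrA ler_wpM2r ?mulr_ge0 ?(ltW S0) // xE e0.
  have tg : 0 <= t * g by rewrite mulr_ge0 ?(ltW t0).
  have tt : 0 <= t * t by rewrite mulr_ge0 ?(ltW t0).
  lra.
move: key; rewrite ler_norml => /andP[k1 k2].
by apply/andP; split; lra.
Qed.

(** At most [r] relative errors of 7/(25 r) [Mp] accumulate to 7/25 [Mp] to first order. Relaxing
    7/25 to 3/10 pays for the higher orders, as [Mp] is at most 181/1000. *)
Lemma corr_pow k u v : (k <= r)%N ->
  1 - 3 / 10 * Mp u v <= (1 - 7 / 25 / r%:R * Mp u v) ^+ k /\
  (1 + 7 / 25 / r%:R * Mp u v) ^+ k <= 1 + 3 / 10 * Mp u v.
Proof.
move=> kr; set x := _ / r%:R * Mp u v.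
have P0 := Mp_ge0 u v; have P1 := Mp_le u v.
have x0 : 0 <= x by rewrite mulr_ge0 // divr_ge0 ?(ltW r0) //; lra.
have kx : k%:R * x <= 7 / 25 * Mp u v.
  have -> : k%:R * x = 7 / 25 * Mp u v * (k%:R / r%:R) by rewrite /x; ring.
  rewrite ler_piMr //; first by lra.
  by rewrite ler_pdivrMr // mul1r ler_nat.
have x1 : x <= 1.
  have : x <= 7 / 25 * Mp u v.
    rewrite /x mulrAC ler_piMr //; first by lra.
    by have := ri_le; lra.
  by lra.
split; first by apply: le_trans (one_subX k x1); lra.
have kx1 : k%:R * x < 1 by lra.
have := one_addX x0 kx1; rewrite -ler_pdivlMr; last by lra.
move=> /le_trans; apply; rewrite mul1r invf_ple ?posrE; try lra.
rewrite -[leLHS]mul1r ler_pdivrMr; last by lra.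
(* With P = [Mp u v], (1 - 7/25 P)(1 + 3/10 P) = 1 + P (1 - 42/10 P)/50, hence at least 1. *)
have : 0 <= Mp u v * (1 - 42 / 10 * Mp u v) by apply: mulr_ge0; lra.
have : (1 - 7 / 25 * Mp u v) * (1 + 3 / 10 * Mp u v) <= (1 - k%:R * x) * (1 + 3 / 10 * Mp u v).
  by rewrite ler_wpM2r //; lra.
lra.
Qed.

(* Expanding over the first vertex y, tilting by u multiplies the y-term by
   R(u) (1 + a u y) with a = O(M); hence raising k by one multiplies the ratio
   Z(huv) Z(h) / (Z(hu) Z(hv)) by 1 + Cov(a u, a v) / (E(1 + a u) E(1 + a v)). *)
Lemma Zpart_corr k j h u v : spread j h -> (j + k + 2 <= r)%N ->
  (1 - 7 / 25 / r%:R * Mp u v) ^+ k *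
    (Zpart phi k (tilt phi h u) * Zpart phi k (tilt phi h v))
  <= Zpart phi k (tilt phi (tilt phi h u) v) * Zpart phi k h
  <= (1 + 7 / 25 / r%:R * Mp u v) ^+ k *
    (Zpart phi k (tilt phi h u) * Zpart phi k (tilt phi h v)).
Proof.
elim: k j h u v => [|k IH] j h u v hh jk; first by rewrite !expr0 !mul1r lexx.
have jk1 : (j + k + 2 <= r)%N by apply: leq_trans jk; rewrite leq_add2r leq_add2l.
have jk0 : (j + k < r)%N by apply: leq_trans jk1; rewrite addn2 ltnS leqnSn.
have [h01 _] := hh.
have hp y : 0 <= h y by have /andP[] := h01 y.
have [Z0 Zt] := Zpart_tilt hh (ltnW jk0).
have [S0 hw] := Zpart_step hh jk0 Z0 Zt.
have Zx x : 0 < Zpart phi k (tilt phi h x).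
  by apply: (Zpart_gt0 (spread_tilt x hh)); rewrite addSn.
pose w y := h y * Zpart phi k (tilt phi h y).
pose ru x := Zpart phi k (tilt phi h x) / Zpart phi k h.
have ru0 x : 0 < ru x by rewrite divr_gt0.
pose a x y := phi x y * Zpart phi k (tilt phi (tilt phi h y) x) /
   Zpart phi k (tilt phi h y) / ru x - 1.
have a1 x y : 1 + a x y = phi x y * Zpart phi k (tilt phi (tilt phi h y) x) /
   Zpart phi k (tilt phi h y) / ru x by rewrite /a addrC subrK.
(* [a x y] is [phi x y * q - 1], where the correlation ratio [q] is within 3/10 [Mp] of 1 by
   induction; so its size is at most [M] + 3/10 [Mp], and [MpM] applies. *)
have aM x y : `|a x y| <= 13 / 10 * M x y.
  have /andP[q1 q2] := IH _ _ x y hh jk1.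
  have [p1 p2] := corr_pow x y (leq_trans (leq_addl j k) (ltnW jk0)).
  pose q := Zpart phi k (tilt phi (tilt phi h x) y) * Zpart phi k h /
     (Zpart phi k (tilt phi h x) * Zpart phi k (tilt phi h y)).
  have Zxy := mulr_gt0 (Zx x) (Zx y).
  have q1' : 1 - 3 / 10 * Mp x y <= q by rewrite ler_pdivlMr // (le_trans _ q1) // ler_wpM2r // ltW.
  have q2' : q <= 1 + 3 / 10 * Mp x y by rewrite ler_pdivrMr // (le_trans q2) // ler_wpM2r // ltW.
  have aE : a x y = phi x y * q - 1.
    rewrite /a /q /ru (Zpart_tiltC _ _ _ y); field.
    by rewrite !gt_eqF.
  have p0 := phi0 x y; have p1' := phi1 x y; have pM := phiM x y.
  have m1 := MpM x y; have m0 := Mp_ge0 x y.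
  have h1 : phi x y * q <= 1 + 3 / 10 * Mp x y.
    apply: le_trans q2'; rewrite ler_piMl //; have := Mp_le x y; lra.
  have h2 : phi x y * (1 - 3 / 10 * Mp x y) <= phi x y * q by rewrite ler_wpM2l.
  have h3 : phi x y * (3 / 10 * Mp x y) <= 3 / 10 * Mp x y by rewrite ler_piMl //; lra.
  by rewrite aE ler_norml; apply/andP; split; lra.
have Z1 x : Zpart phi k.+1 (tilt phi h x) = ru x * \sum_y w y * (1 + a x y).
  rewrite /= mulr_sumr; apply: eq_bigr => y _.
  rewrite a1 /w Zpart_tiltC /tilt -!/(tilt _ _ _); field.
  by rewrite !gt_eqF.
have wS : \sum_y w y = Zpart phi k.+1 h by rewrite /w.
have hw' y : 0 <= w y <= 4 / 3 / n * \sum_y w y by rewrite wS; exact: hw.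
have S0' : 0 < \sum_y w y by rewrite wS.
have /andP[c1 c2] := covariance_bound S0' hw' (aM u) (aM v).
set x := 7 / 25 / r%:R * Mp u v in c1 c2 IH *.
have Z2 y : Zpart phi k (tilt phi (tilt phi (tilt phi h u) v) y) =
    Zpart phi k (tilt phi (tilt phi (tilt phi h y) u) v).
  by apply: eq_Zpart => z; rewrite /tilt; ring.
pose sab := \sum_y w y * ((1 + a u y) * (1 + a v y)).
have hy y : spread j.+1 (tilt phi h y) by exact: spread_tilt.
have jky : (j.+1 + k + 2 <= r)%N by rewrite addSnnS.
have term y : ru u * ru v * (w y * ((1 + a u y) * (1 + a v y))) =
   h y * phi u y * phi v y / Zpart phi k (tilt phi h y) *
   (Zpart phi k (tilt phi (tilt phi h y) u) * Zpart phi k (tilt phi (tilt phi h y) v)).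
  by rewrite !a1 /w; field; rewrite !gt_eqF.
have term2 y : tilt phi (tilt phi h u) v y * Zpart phi k (tilt phi (tilt phi (tilt phi h u) v) y) =
   h y * phi u y * phi v y / Zpart phi k (tilt phi h y) *
   (Zpart phi k (tilt phi (tilt phi (tilt phi h y) u) v) * Zpart phi k (tilt phi h y)).
  rewrite Z2 /tilt -!/(tilt _ _ _); field.
  by rewrite gt_eqF.
have c0 y : 0 <= h y * phi u y * phi v y / Zpart phi k (tilt phi h y).
  by rewrite divr_ge0 ?(ltW (Zx y)) // !mulr_ge0.
have ruv : 0 < ru u * ru v by rewrite mulr_gt0.
have x0 : 0 <= x by rewrite mulr_ge0 ?Mp_ge0 // divr_ge0 ?(ltW r0) //; lra.
have x1 : x <= 1.
  have := Mp_le u v; have : x <= 7 / 25 * Mp u v.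
    rewrite /x mulrAC ler_piMr //; first by have := Mp_ge0 u v; lra.
    by have := ri_le; lra.
  by lra.
(* Induction for the activity tilted by [y] splits the double tilt in each [y]-term at the price of
   k factors 1 - x, or 1 + x for [high]; the last factor comes from [covariance_bound]. *)
have low : (1 - x) ^+ k * (ru u * ru v * sab) <= Zpart phi k.+1 (tilt phi (tilt phi h u) v).
  rewrite /= /sab !mulr_sumr ler_sum // => y _; rewrite term term2 mulrCA ler_wpM2l //.
  by have /andP[] := IH _ _ u v (hy y) jky.
have high : Zpart phi k.+1 (tilt phi (tilt phi h u) v) <= (1 + x) ^+ k * (ru u * ru v * sab).
  rewrite /= /sab !mulr_sumr ler_sum // => y _; rewrite term term2 [leRHS]mulrCA ler_wpM2l //.
  by have /andP[] := IH _ _ u v (hy y) jky.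
rewrite !Z1 -wS; apply/andP; split.
- apply: le_trans (_ : (1 - x) ^+ k * (ru u * ru v * sab) * \sum_y w y <= _); last first.
    by rewrite ler_wpM2r ?(ltW S0').
  rewrite [leLHS](_ : _ = (1 - x) ^+ k * (ru u * ru v) *
    ((1 - x) * ((\sum_y w y * (1 + a u y)) * \sum_y w y * (1 + a v y)))); last by rewrite exprS; ring.
  rewrite [leRHS](_ : _ = (1 - x) ^+ k * (ru u * ru v) * (sab * \sum_y w y)); last by ring.
  by rewrite ler_wpM2l // mulr_ge0 ?(ltW ruv) // exprn_ge0 // subr_ge0.
- apply: le_trans (_ : (1 + x) ^+ k * (ru u * ru v * sab) * \sum_y w y <= _).
    by rewrite ler_wpM2r ?(ltW S0').
  rewrite [leRHS](_ : _ = (1 + x) ^+ k * (ru u * ru v) *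
    ((1 + x) * ((\sum_y w y * (1 + a u y)) * \sum_y w y * (1 + a v y)))); last by rewrite exprS; ring.
  rewrite [leLHS](_ : _ = (1 + x) ^+ k * (ru u * ru v) * (sab * \sum_y w y)); last by ring.
  by rewrite ler_wpM2l // mulr_ge0 ?(ltW ruv) // exprn_ge0 // addr_ge0.
Qed.


End Estimates.
End Gibbs.

(** * Partition functions as sums over vertex sets *)

Section SetSums.
Context {R : realFieldType} {V : finType}.
Variables (phi : V -> V -> R) (c : {set V} -> R).
Hypothesis phixx : forall x, phi x x = 0.
Hypothesis c0 : c set0 = 1.
Hypothesis cU : forall x (S : {set V}), x \notin S -> c (x |: S) = c S * \prod_(y in S) phi x y.

(** By [c0] and [cU], [c S] is the product of [phi] over the unordered pairs in [S]; characterising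
    it by recursion avoids choosing an order in each pair. *)
Definition set_weight (h : V -> R) (S : {set V}) : R := (\prod_(x in S) h x) * c S.

Lemma set_weightU h x (S : {set V}) : x \notin S ->
  set_weight h (x |: S) = h x * set_weight (tilt phi h x) S.
Proof.
move=> xS; rewrite /set_weight big_setU1 //= cU // /tilt big_split /=.
by rewrite -!mulrA; congr (_ * (_ * _)); rewrite mulrC.
Qed.

Lemma set_weight_tilt0 h x (S : {set V}) : x \in S -> set_weight (tilt phi h x) S = 0.
Proof.
by move=> xS; rewrite /set_weight (big_setD1 x) //= /tilt phixx mulr0 !mul0r.
Qed.

(** Deleting [x] is a bijection onto the sets avoiding [x]. On the right, sets containing [x] have
    weight 0 because [phi x x = 0], so [Q] is unconstrained on them. *)
Lemma sum_set_weight_mem h x (P Q : pred {set V}) :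
  (forall S : {set V}, x \notin S -> P (x |: S) = Q S) ->
  \sum_(S : {set V} | (x \in S) && P S) set_weight h S =
  h x * \sum_(S | Q S) set_weight (tilt phi h x) S.
Proof.
move=> PQ; rewrite (bigID (fun S : {set V} => x \in S) Q) /=.
rewrite [X in _ = _ * (X + _)]big1 ?add0r; last by move=> S /andP[_ xS]; exact: set_weight_tilt0.
rewrite mulr_sumr (reindex_onto (fun S => x |: S) (fun S => S :\ x)) /=; last first.
  by move=> S /andP[xS _]; rewrite setD1K.
apply: eq_big => [S|S /andP[_ /eqP SE]]; last first.
  by rewrite set_weightU // -SE setD11.
rewrite setU11 /=; have [xS|xS] := boolP (x \in S).
  rewrite andbF; apply/negP => /andP[_ /eqP SE].
  by move: xS; rewrite -SE setD11.
by rewrite PQ // setU1K // eqxx.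
Qed.

(** Tuples with a repeated vertex vanish and a [k]-set has k! orderings. In the induction, choosing
    the first point counts each set of size k + 1 once per element. *)
Lemma Zpart_set_sum k h :
  Zpart phi k h = k`!%:R * \sum_(S : {set V} | #|S| == k) set_weight h S.
Proof.
elim: k h => [|k IH] h.
  rewrite fact0 mul1r (big_pred1 set0) => [|S]; last by rewrite cards_eq0.
  by rewrite /set_weight big_set0 c0 mulr1.
rewrite /=; under eq_bigr => x _.
  rewrite IH mulrCA -(@sum_set_weight_mem h x (fun S => #|S| == k.+1)); last first.
    by move=> S xS; rewrite cardsU1 xS add1n eqSS.
  over.
rewrite -mulr_sumr factS natrM -mulrA mulrCA; congr (_ * _).
rewrite (eq_bigr (fun x => \sum_(S : {set V} | #|S| == k.+1)
    if x \in S then set_weight h S else 0)); last first.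
  move=> x _; rewrite big_mkcond [RHS]big_mkcond; apply: eq_bigr => S _ /=.
  by case: (x \in S); case: (_ == _).
rewrite exchange_big /= mulr_sumr; apply: eq_bigr => S /eqP SE.
by rewrite -big_mkcond /= sumr_const SE mulr_natl.
Qed.

Lemma sum_set_weight_pair k h u v : u != v ->
  \sum_(S : {set V} | [&& u \in S, v \in S & #|S| == k.+2]) set_weight h S =
  h u * (h v * phi u v) * (\sum_(S : {set V} | #|S| == k) set_weight (tilt phi (tilt phi h u) v) S).
Proof.
move=> uv.
rewrite (@sum_set_weight_mem h u _ (fun S => (v \in S) && (#|S| == k.+1))); last first.
  by move=> S uS; rewrite in_setU1 eq_sym (negPf uv) cardsU1 uS add1n eqSS.
rewrite (@sum_set_weight_mem _ v _ (fun S => #|S| == k)); last first.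
  by move=> S vS; rewrite cardsU1 vS add1n eqSS.
by rewrite mulrA.
Qed.

End SetSums.

(** * A variational inequality *)

(** From exp(-y) >= 1 - y follows exp(y) <= 1/(1 - y), and (1 + y + 2 y^2)(1 - y) = 1 + y^2 (1 - 2
    y). *)
Lemma expR_le_quad (R : realType) (y : R) : `|y| <= 1 / 2 -> expR y <= 1 + y + 2 * y ^+ 2.
Proof.
rewrite ler_norml => /andP[y1 y2].
have e1 : 1 - y <= (expR y)^-1 by rewrite -expRN; exact: expR_ge1Dx.
have e2 : expR y * (1 - y) <= 1.
  by rewrite -ler_pdivlMl ?expR_gt0 // mulr1.
have q : 1 <= (1 + y + 2 * y ^+ 2) * (1 - y).
  have : 0 <= y ^+ 2 * (1 - 2 * y) by rewrite mulr_ge0 ?sqr_ge0 //; lra.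
  rewrite expr2; lra.
have y0 : 0 < 1 - y by lra.
by rewrite -(ler_pM2r y0) (le_trans e2).
Qed.

(** Extreme value theorem on a compact box of row vectors. Continuity of [F] is required along
    continuous families indexed by row vectors, so that no topology on [I -> R] is involved. *)
Lemma box_min (R : realType) (I : finType) (lo hi : I -> R) (F : (I -> R) -> R) :
  (forall i, lo i <= hi i) ->
  (forall n (g : 'rV[R]_n -> I -> R), (forall i, continuous (fun v => g v i)) ->
     continuous (fun v => F (g v))) ->
  exists2 p, (forall i, lo i <= p i <= hi i) &
    forall q, (forall i, lo i <= q i <= hi i) -> F p <= F q.
Proof.
move=> lohi Fc.
pose g (v : 'rV[R]_#|I|) i := v ord0 (enum_rank i).
pose A : set 'rV[R]_#|I| :=
  [set v | forall k : 'I_#|I|, `[lo (enum_val k), hi (enum_val k)]%classic (v ord0 k)]%classic.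
have cA : compact A.
  exact: (@rV_compact _ #|I| (fun k => `[lo (enum_val k), hi (enum_val k)]%classic)
    (fun k => @segment_compact R _ _)).
have A0 : (A !=set0)%classic.
  by exists (\row_k lo (enum_val k)) => k /=; rewrite mxE in_itv /= lexx lohi.
have Fg : continuous (fun v => F (g v)).
  by apply: Fc => i v; exact: coord_continuous.
have [v Av vmin] := EVT_min_rV A0 cA (continuous_subspaceT Fg).
exists (g v) => [i|q qbox].
  by have := set_mem Av (enum_rank i); rewrite /= in_itv /= enum_rankK.
pose t : 'rV[R]_#|I| := \row_k q (enum_val k).
have At : t \in A.
  by apply: mem_set => k /=; rewrite mxE in_itv /= qbox.
apply: le_trans (vmin t At) _; rewrite le_eqVlt; apply/orP; left; apply/eqP.
congr F; apply/funext => i; by rewrite /g mxE enum_rankK.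
Qed.

(** First-order optimality: at a minimiser of this sum of exponentials the derivative towards any
    point of the box is nonnegative. The quadratic bound on [expR] replaces differentiation. *)
Lemma box_variational (R : realType) (I J : finType) (P : pred J)
    (lo hi : I -> R) (c : J -> I -> R) : (forall i, lo i <= hi i) ->
  exists2 p, (forall i, lo i <= p i <= hi i) &
    forall q, (forall i, lo i <= q i <= hi i) ->
    0 <= \sum_(j | P j) expR (\sum_i c j i * p i) * \sum_i c j i * (q i - p i).
Proof.
move=> lohi.
pose F (p : I -> R) := \sum_(j | P j) expR (\sum_i c j i * p i).
have [|p pbox pmin] := @box_min R I lo hi F lohi.
  have addc : continuous (fun x : R * R => x.1 + x.2) by exact: add_continuous.
  move=> n g gc.
  apply: (@continuous_big _ _ +%R 0 P addc _ (index_enum J)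
    (fun j v => expR (\sum_i c j i * g v i))) => j _ v.
  apply: (@continuous_comp _ _ _ (fun v => \sum_i c j i * g v i) expR); last exact: continuous_expR.
  apply: (@continuous_big _ _ +%R 0 predT addc _ (index_enum I)
    (fun i v => c j i * g v i)) => i _ w.
  apply: (@continuousM R _ (fun=> c j i) (fun v => g v i)); last exact: gc.
  exact: cst_continuous.
exists p => // q qbox.
pose e j := expR (\sum_i c j i * p i); pose d j := \sum_i c j i * (q i - p i).
rewrite -/(\sum_(j | P j) e j * d j) leNgt; apply/negP => D0.
set D := \sum_(j | P j) _ in D0.
pose B := \sum_(j | P j) e j * d j ^+ 2.
have B0 : 0 <= B by apply: sumr_ge0 => j _; rewrite mulr_ge0 ?expR_ge0 ?sqr_ge0.
pose m := 1 + \sum_(j | P j) `|d j|.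
have m1 : 1 <= m by rewrite /m lerDl sumr_ge0.
have dm j : P j -> `|d j| <= m.
  move=> Pj; rewrite /m (bigD1 j) //=.
  have : 0 <= \sum_(i | P i && (i != j)) `|d i| by apply: sumr_ge0.
  lra.
(* The first bound makes [expR_le_quad] applicable to every [s * d j]; the second keeps the
   quadratic term 2 s^2 B at most -sD/2, so the step strictly decreases [F]. The 1 in [B + 1] avoids
   division by 0. *)
pose s := Num.min (2 * m)^-1 (- D / (4 * (B + 1))).
have s0 : 0 < s.
  by rewrite lt_min invr_gt0 divr_gt0 /= ?andbT; [lra | lra | lra].
have s1 : s * m <= 1 / 2.
  have m0 : 0 < m := lt_le_trans ltr01 m1.
  apply: le_trans (_ : (2 * m)^-1 * m <= _).
    by apply: ler_wpM2r; [exact: ltW | rewrite ge_min lexx].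
  by rewrite invfM mulfVK ?gt_eqF // div1r.
have s2 : s * (4 * (B + 1)) <= - D.
  by rewrite -ler_pdivlMr ?ge_min ?lexx ?orbT //; lra.
have := pmin (fun i => p i + s * (q i - p i)).
have qb i : lo i <= p i + s * (q i - p i) <= hi i.
  have /andP[p1 p2] := pbox i; have /andP[q1 q2] := qbox i.
  have s3 : s <= 1.
    have := ler_wpM2l (ltW s0) m1; rewrite mulr1; lra.
  apply/andP; split.
  - have := mulr_ge0 (ltW s0) (_ : 0 <= q i - lo i).
    have : 0 <= (1 - s) * (p i - lo i) by apply: mulr_ge0; lra.
    move=> h1 h2; have := h2 ltac:(lra); lra.
  - have := mulr_ge0 (ltW s0) (_ : 0 <= hi i - q i).
    have : 0 <= (1 - s) * (hi i - p i) by apply: mulr_ge0; lra.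
    move=> h1 h2; have := h2 ltac:(lra); lra.
move=> /(_ qb); apply/negP; rewrite -ltNge.
have le1 : F (fun i => p i + s * (q i - p i)) <= F p + s * D + 2 * s ^+ 2 * B.
  rewrite /F /D /B !mulr_sumr -!big_split /=; apply: ler_sum => j Pj.
  have -> : \sum_i c j i * (p i + s * (q i - p i)) =
     \sum_i c j i * p i + s * d j.
    rewrite /d mulr_sumr -big_split; apply: eq_bigr => i _ /=; ring.
  rewrite expRD -/(e j).
  have h : `|s * d j| <= 1 / 2.
    rewrite normrM (gtr0_norm s0); apply: le_trans s1.
    by rewrite ler_wpM2l ?(ltW s0) // dm.
  have := ler_wpM2l (expR_ge0 (\sum_i c j i * p i)) (expR_le_quad h).
  rewrite -/(e j) !expr2; lra.
apply: le_lt_trans le1 _.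
have : s * (s * (4 * (B + 1))) <= s * (- D) by rewrite ler_wpM2l ?(ltW s0).
have : s * D < 0 by rewrite pmulr_rlt0.
have : 0 <= s * s by rewrite mulr_ge0 ?(ltW s0).
rewrite expr2; lra.
Qed.

(** * The majorant and the random field *)

Section Majorant.
Local Open Scope classical_set_scope.
Local Open Scope ring_scope.
Context {R : realType} {V : finType}.
Variables (a : V -> V -> R) (r : nat).
Let n : R := #|V|%:R.
Hypothesis r4 : (4 <= r)%N.
Hypothesis n0 : 0 < n.
Hypothesis a01 : forall x y, 0 <= a x y <= 1.
Hypothesis aC : forall x y, a x y = a y x.
Hypothesis arow : forall x, \sum_y a x y <= n / (100 * r%:R).

Let r0 : 0 < r%:R :> R. Proof. by rewrite ltr0n; case: r r4. Qed.
Let r4R : 4 <= r%:R :> R. Proof. by rewrite ler_nat. Qed.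
Let ri_le : r%:R^-1 <= 1 / 4 :> R.
Proof. by rewrite mul1r lef_pV2 ?posrE. Qed.
Let ri_gt0 : 0 < r%:R^-1 :> R. Proof. by rewrite invr_gt0. Qed.

(** A fixed point dominates both the non-edges [a] and the correlation bound that it itself
    generates, namely the [Mp] of the estimates above. *)
Definition maj_step (M : V -> V -> R) x y : R :=
  a x y + 9 * (r%:R / n * \sum_z M x z * M y z) + (250 * r%:R)^-1.

Definition majorant_inv (M : V -> V -> R) : Prop :=
  [/\ forall x y, 0 <= M x y <= 6 / 5,
      forall x y, M x y = M y x &
      forall x, \sum_y M x y <= n / (60 * r%:R)].

Lemma majorant_inv_corr M x y : majorant_inv M ->
  0 <= r%:R / n * (\sum_z M x z * M y z) <= 1 / 50.
Proof.
move=> [M01 _ Mrow].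
have M0 u v : 0 <= M u v by have /andP[] := M01 u v.
rewrite mulr_ge0 ?divr_ge0 ?(ltW r0) ?(ltW n0) ?sumr_ge0 //=; last first.
  by move=> z _; rewrite mulr_ge0.
apply: le_trans (_ : r%:R / n * (n / (60 * r%:R) * (6 / 5)) <= _); last first.
  rewrite le_eqVlt; apply/orP; left; apply/eqP; field; by rewrite !gt_eqF.
rewrite ler_wpM2l ?divr_ge0 ?(ltW r0) ?(ltW n0) //.
apply: le_trans (_ : (\sum_z M x z) * (6 / 5) <= _); last first.
  by apply: ler_wpM2r => //; lra.
rewrite mulr_suml ler_sum // => z _; rewrite ler_wpM2l //.
by have /andP[] := M01 y z.
Qed.

(** Entries: 1 + 9/50 + 1/1000 is below 6/5. Row sums, in units of n/r: 1/100 + 9/3600 + 1/250 =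
    0.0165 is below 1/60. The density 1/100 of the non-edges enters here. *)
Lemma maj_step_inv M : majorant_inv M -> majorant_inv (maj_step M).
Proof.
move=> MI; have [M01 MC Mrow] := MI.
have t0 := ri_gt0; have t1 := ri_le.
split.
- move=> x y; have /andP[g0 g1] := majorant_inv_corr x y MI.
  have /andP[a0 a1] := a01 x y; rewrite /maj_step invfM; apply/andP; split; lra.
- move=> x y; rewrite /maj_step aC; congr (_ + 9 * (_ * _) + _).
  by apply: eq_bigr => z _; rewrite mulrC.
- move=> x; rewrite /maj_step !big_split /=.
  rewrite -!mulr_sumr sumr_const.
  have -> : \sum_y \sum_z M x z * M y z = \sum_z M x z * \sum_y M z y.
    rewrite exchange_big; apply: eq_bigr => z _; rewrite mulr_sumr.
    by apply: eq_bigr => y _; rewrite (MC y).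
  have h : \sum_z M x z * \sum_y M z y <= n / (60 * r%:R) * (n / (60 * r%:R)).
    apply: le_trans (_ : (\sum_z M x z) * (n / (60 * r%:R)) <= _).
      rewrite mulr_suml ler_sum // => z _; rewrite ler_wpM2l //.
      by have /andP[] := M01 x z.
    by rewrite ler_wpM2r // divr_ge0 ?(ltW n0) // mulr_ge0 // ltW.
  have h2 : r%:R / n * (\sum_z M x z * \sum_y M z y) <= n / r%:R / 3600.
    apply: le_trans (ler_wpM2l _ h) _; first by rewrite divr_ge0 ?(ltW r0) ?(ltW n0).
    by rewrite le_eqVlt; apply/orP; left; apply/eqP; field; rewrite !gt_eqF.
  have c (b : R) : n / (b * r%:R) = b^-1 * (n / r%:R) by rewrite invfM mulrCA.
  have := arow x; rewrite -mulr_natl -/n !c.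
  have : 0 <= n / r%:R by rewrite divr_ge0 ?(ltW n0) ?(ltW r0).
  lra.
Qed.

Let it i : V -> V -> R := iter i maj_step (fun _ _ => 0).

Let it_inv i : majorant_inv (it i).
Proof.
elim: i => [|i IH]; last exact: maj_step_inv.
split=> [x y|//|x]; first by rewrite lexx /=; lra.
by rewrite /= sumr_const mul0rn divr_ge0 ?(ltW n0) // mulr_ge0 // ltW.
Qed.

Let it_mono i x y : it i x y <= it i.+1 x y.
Proof.
elim: i x y => [|i IH] x y; first by have [/(_ x y)/andP[]] := it_inv 1.
rewrite /= /maj_step lerD2r lerD2l ler_wpM2l // ler_wpM2l ?divr_ge0 ?(ltW r0) ?(ltW n0) //.
apply: ler_sum => z _; have [h _ _] := it_inv i.
by apply: ler_pM; [have /andP[] := h x z | have /andP[] := h y z | exact: IH | exact: IH].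
Qed.

(** Iterating from 0 is monotone and bounded, so it converges entrywise; the finite sums in
    [maj_step] pass to the limit. *)
Lemma majorant_exists : exists2 M, majorant_inv M & forall x y, M x y = maj_step M x y.
Proof.
pose M x y := limn (fun i => it i x y).
have cM x y : (fun i => it i x y) @ \oo --> M x y.
  apply: nondecreasing_is_cvgn.
    by apply/nondecreasing_seqP => i; exact: it_mono.
  by exists (6 / 5) => _ [i _ <-]; have [/(_ x y)/andP[]] := it_inv i.
have cs (F : V -> nat -> R) (L : V -> R) : (forall z, F z @ \oo --> L z) ->
    (fun i => \sum_z F z i) @ \oo --> \sum_z L z.
  have addc : continuous (fun x : R * R => x.1 + x.2) by exact: add_continuous.
  by move=> FL; apply: (cvg_big addc) => z _; exact: FL.
exists M.
  split.
  - move=> x y; apply/andP; split.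
      apply: limr_ge; first exact: cvgP (cM x y).
      by apply: nearW => i; have [/(_ x y)/andP[]] := it_inv i.
    apply: limr_le; first exact: cvgP (cM x y).
    by apply: nearW => i; have [/(_ x y)/andP[]] := it_inv i.
  - move=> x y; rewrite /M (_ : (fun i => it i x y) = (fun i => it i y x)) //.
    by apply/funext => i; have [_ ->] := it_inv i.
  - move=> x; have cS := cs _ _ (cM x).
    rewrite -(cvg_lim _ cS) //; apply: limr_le; first exact: cvgP cS.
    by apply: nearW => i; have [_ _] := it_inv i; apply.
move=> x y.
have c1 : (fun i => it i.+1 x y) @ \oo --> M x y.
  by have := cM x y; rewrite -cvg_shiftS.
have c2 : (fun i => it i.+1 x y) @ \oo --> maj_step M x y.
  rewrite /= /maj_step; apply: cvgD; last exact: cvg_cst.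
  apply: cvgD; first exact: cvg_cst.
  apply: cvgM; first exact: cvg_cst.
  apply: cvgM; first exact: cvg_cst.
  by apply: cs => z; apply: cvgM; exact: cM.
exact: (cvg_unique _ c1 c2).
Qed.

End Majorant.

(** * Numerical estimates for the random field *)

Lemma exprD1_le_expR (R : realType) (x : R) k : -1 <= x -> (1 + x) ^+ k <= expR (k%:R * x).
Proof.
move=> x1; rewrite expRM_natl lerXn2r ?nnegrE ?expR_ge0 //; last exact: expR_ge1Dx.
lra.
Qed.

Lemma prod_one_sub_ge (R : realFieldType) (I : Type) (s : seq I) (x : I -> R) :
  (forall i, 0 <= x i <= 1) -> 1 - \sum_(i <- s) x i <= \prod_(i <- s) (1 - x i).
Proof.
move=> x01; suff : 1 - \sum_(i <- s) x i <= \prod_(i <- s) (1 - x i) <= 1 by case/andP.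
elim: s => [|i s /andP[h1 h2]]; first by rewrite !big_nil subr0 lexx.
rewrite !big_cons; have /andP[x0 x1] := x01 i.
have p0 : 0 <= \prod_(j <- s) (1 - x j).
  by apply: prodr_ge0 => j _; have /andP[] := x01 j; lra.
have := ler_wpM2l x0 h2; have := mulr_ge0 x0 p0.
by move=> *; apply/andP; split; lra.
Qed.

(** Read t = 1/r, N = 12 r, g = (r/n) M^2, and p, q as row averages of [M]. The power is about exp(3
    g): this outweighs the loss 27/10 g in the first claim, and 3 + 27/10 stays below 9 in the
    second. The deficit 11/5000 = 1/1000 + (3/10)/250 collects the errors of order t in the first
    claim. *)
Lemma corr_numeric (R : realType) (t p q g : R) (N : nat) :
  0 < t -> t <= 1 / 4 -> 0 <= p -> p <= t / 60 -> 0 <= q -> q <= t / 60 ->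
  0 <= g -> g <= 1 / 50 -> N%:R * t = 12 ->
  1 - 11 / 50 / 100 * t <=
    ((1 - p / 2 - q / 2 + t * g / 4) / ((1 - p / 2) * (1 - q / 2))) ^+ N *
    (1 - 3 / 10 * (9 * g + t / 250)) /\
  ((1 - p / 2 - q / 2 + t * g / 4) / ((1 - p / 2) * (1 - q / 2))) ^+ N *
    (1 + 3 / 10 * (9 * g + t / 250)) * expR (- (9 * g + t / 250)) <= 1 - 11 / 50 / 100 * t.
Proof.
move=> t0 t1 p0 p1 q0 q1 g0 g1 rt.
pose D := (1 - p / 2) * (1 - q / 2).
have pq0 := mulr_ge0 p0 q0; have pq1 := ler_pM p0 q0 p1 q1.
have D1 : 99 / 100 <= D.
  apply: le_trans (_ : 199 / 200 * (199 / 200) <= _); first by lra.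
  by apply: ler_pM; lra.
have D2 : D <= 1 by apply: mulr_ile1; lra.
have D0 : 0 < D by lra.
pose y := (t * g - p * q) / 4 / D.
have piE : (1 - p / 2 - q / 2 + t * g / 4) / ((1 - p / 2) * (1 - q / 2)) = 1 + y.
  by rewrite /y /D; field; apply/andP; split; rewrite gt_eqF //; lra.
have tg : 0 <= t * g by rewrite mulr_ge0 // ltW.
have tt0 : 0 <= t * t by rewrite mulr_ge0 // ltW.
have tt1 := ler_wpM2l (ltW t0) t1.
have tgD1 := ler_wpM2l tg D1; have tgD2 := ler_wpM2l tg D2.
have ttD1 := ler_wpM2l tt0 D1.
(* 26/100 exceeds 1/(4 D) because D is at least 99/100; multiplying by N t = 12 gives 312/100
   below. *)
have yu : y <= t * g * (26 / 100) by rewrite ler_pdivrMr //; lra.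
have yl : t * g / 4 - t / 60 * (t / 60) * (26 / 100) <= y by rewrite ler_pdivlMr //; lra.
have y1 : -1 <= y by lra.
have N0 : 0 <= N%:R :> R by [].
have qyu : N%:R * y <= 312 / 100 * g.
  apply: le_trans (ler_wpM2l N0 yu) _.
  have -> : N%:R * (t * g * (26 / 100)) = N%:R * t * (g * (26 / 100)) by ring.
  by rewrite rt; lra.
have qyl : 3 * g - t / 10 / 100 <= N%:R * y.
  apply: le_trans (ler_wpM2l N0 yl).
  rewrite (_ : _ * (_ - _) = N%:R * t * (g / 4 - t / 60 / 60 * (26 / 100))); last by field.
  by rewrite rt; lra.
have gg := ler_wpM2l g0 g1; have gt0 := mulr_ge0 g0 (ltW t0); have gt1 := ler_wpM2l g0 t1.
rewrite piE; split.
  apply: le_trans (_ : (1 + (3 * g - t / 10 / 100)) * (1 - 3 / 10 * (9 * g + t / 250)) <= _).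
    by clear -gg gt0 gt1 tt0 t0 t1 g0 g1; lra.
  rewrite ler_wpM2r //; first by lra.
  apply: le_trans (bernoulli _ y1); lra.
set P := 9 * g + t / 250.
apply: le_trans (_ : expR (312 / 100 * g) * expR (3 / 10 * P) * expR (- P) <= _).
  rewrite ler_wpM2r ?expR_ge0 //; apply: ler_pM; rewrite ?exprn_ge0 //; rewrite /P; try lra.
    apply: le_trans (exprD1_le_expR _ y1) _; rewrite ler_expR; lra.
  exact: expR_ge1Dx.
rewrite -!expRD; set z := _ + _ - _.
(* The coefficient of g in z is negative, and the constant in P leaves -(7/10) t/250 = -(7/2500) t,
   which beats the deficit 11/5000 t. *)
have zt : 7 / 25 / 100 * t <= - z by rewrite /z /P; lra.
have ez : expR z * (1 + 7 / 25 / 100 * t) <= 1.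
  have zz : expR z * expR (- z) = 1 by rewrite -expRD addrN expR0.
  rewrite -[leRHS]zz; apply: ler_wpM2l; first exact: expR_ge0.
  by apply: le_trans (expR_ge1Dx _); rewrite lerD2l.
rewrite -(@ler_pM2r _ (1 + 7 / 25 / 100 * t)); last by lra.
apply: le_trans ez _; lra.
Qed.

(** * The ghost field and its moments *)

Section Ghosts.
Context {R : realType} {V : finType}.
Variables (M : V -> V -> R) (r : nat).
Let n : R := #|V|%:R.
Hypothesis r4 : (4 <= r)%N.
Hypothesis n0 : 0 < n.
Hypothesis M01 : forall x y, 0 <= M x y <= 6 / 5.
Hypothesis MC : forall x y, M x y = M y x.
Hypothesis Mrow : forall x, \sum_y M x y <= n / (60 * r%:R).

Let r0 : 0 < r%:R :> R. Proof. by rewrite ltr0n; case: r r4. Qed.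
Let r4R : 4 <= r%:R :> R. Proof. by rewrite ler_nat. Qed.
Let t : R := r%:R^-1.
Let t1 : t <= 1 / 4. Proof. by rewrite mul1r lef_pV2 ?posrE. Qed.
Let t0 : 0 < t. Proof. by rewrite invr_gt0. Qed.
Let M0 x y : 0 <= M x y. Proof. by have /andP[] := M01 x y. Qed.

(* 12 r ghosts give the field covariance about 3 (r/n) M^2, which beats the
   error 3/10 * 9 (r/n) M^2 of the correlation estimate. *)
Definition ghost : finType := {ffun 'I_(12 * r) -> V}.

Definition ghost_field (w : ghost) (u : V) : R := \prod_i (1 - M u (w i) / 2).

(** [mean1] and [mean2] are expectations over one uniform ghost. Ghosts being independent, the
    moments of the field are their powers of exponent 12 r. *)
Definition mean1 u : R := 1 - (\sum_z M u z) / n / 2.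
Definition mean2 u v : R := (\sum_z (1 - M u z / 2) * (1 - M v z / 2)) / n.

Lemma ghost_field_gt0 w u : 0 < ghost_field w u.
Proof. by apply: prodr_gt0 => i _; have /andP[_] := M01 u (w i); lra. Qed.

Lemma half01 u z : 0 <= M u z / 2 <= 1.
Proof. by have /andP[] := M01 u z; move=> *; apply/andP; split; lra. Qed.

Lemma ghost_field_le1 w u : ghost_field w u <= 1.
Proof.
by apply: prodr_ile1 => i _; have /andP[] := half01 u (w i); move=> *; apply/andP; split; lra.
Qed.

(** Each of the 12 r ghosts removes at most half a column sum of [M], that is n/(120 r), in total
    n/10. Symmetry of [M] turns columns into rows. *)
Lemma sum_ghost_field_ge w : n * (9 / 10) <= \sum_u ghost_field w u.
Proof.
apply: le_trans (_ : \sum_u (1 - \sum_i M u (w i) / 2) <= _); last first.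
  apply: ler_sum => u _; apply: prod_one_sub_ge => i; exact: half01.
rewrite big_split /= sumr_const -mulr_natr mul1r -/n sumrN exchange_big /=.
apply: le_trans (_ : n - \sum_(i < 12 * r) n / (60 * r%:R) / 2 <= _); last first.
  rewrite lerD2l lerN2 ler_sum // => i _; rewrite -mulr_suml ler_wpM2r //; last first.
    by apply: le_trans (Mrow (w i)); apply: ler_sum => u _; rewrite MC.
rewrite sumr_const card_ord -[_ *+ (12 * r)]mulr_natl natrM le_eqVlt; apply/orP; left; apply/eqP; field.
by rewrite gt_eqF.
Qed.

Lemma sum_ghost (F : V -> R) : \sum_(w : ghost) \prod_i F (w i) = (\sum_z F z) ^+ (12 * r).
Proof.
transitivity (\prod_(i < 12 * r) \sum_z F z); last by rewrite prodr_const card_ord.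
by rewrite (bigA_distr_bigA (fun=> F)).
Qed.

Lemma sum_ghost_field2 u v :
  \sum_(w : ghost) ghost_field w u * ghost_field w v = (n * mean2 u v) ^+ (12 * r).
Proof.
under eq_bigr => w _ do rewrite /ghost_field -big_split /=.
by rewrite (sum_ghost (fun z => (1 - M u z / 2) * (1 - M v z / 2))) /mean2 mulrC divfK ?gt_eqF.
Qed.

Let mu_le u : 0 <= (\sum_z M u z) / n <= t / 60.
Proof.
rewrite divr_ge0 ?(ltW n0) ?sumr_ge0 //= ler_pdivrMr //.
rewrite (_ : t / 60 * n = n / (60 * r%:R)) //.
by rewrite /t; field; rewrite gt_eqF.
Qed.

Definition norm1 u : R := mean1 u ^+ (12 * r).

Lemma norm1_bounds u : 9 / 10 <= norm1 u <= 1.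
Proof.
have /andP[m0 m1] := mu_le u; have ht := t1; have ht0 := t0.
apply/andP; split; last by rewrite exprn_ile1 // /mean1; lra.
rewrite /norm1 /mean1 -mulrN.
apply: le_trans (bernoulli _ _); last by lra.
have : 12 * (r%:R * ((\sum_z M u z) / n)) <= 12 * (r%:R * (t / 60)).
  by rewrite ler_wpM2l // ler_wpM2l // ltW.
have -> : r%:R * (t / 60) = 1 / 60 by rewrite /t mulrA mulfV ?gt_eqF.
rewrite natrM; lra.
Qed.

Let G2 u v : R := r%:R / n * \sum_z M u z * M v z.
Let Mp u v : R := 9 * G2 u v + (250 * r%:R)^-1.
Hypothesis G2_bounds : forall u v, 0 <= G2 u v <= 1 / 50.

(** The ratio E[s(u) s(v)] / (E s(u) E s(v)) for the ghost field s. *)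
Definition corr u v : R := (mean2 u v / (mean1 u * mean1 v)) ^+ (12 * r).

(** The two halves keep the corrected edge parameter in its box: the first makes it at most 0, the
    second at least -[Mp]. *)
Lemma corr_bounds u v :
  1 - 11 / 50 / 100 * t <= corr u v * (1 - 3 / 10 * Mp u v) /\
  corr u v * (1 + 3 / 10 * Mp u v) * expR (- Mp u v) <= 1 - 11 / 50 / 100 * t.
Proof.
have /andP[p0 p1] := mu_le u; have /andP[q0 q1] := mu_le v.
have /andP[g0 g1] := G2_bounds u v.
set p := _ / n in p0 p1; set q := _ / n in q0 q1; set g := G2 u v in g0 g1.
have MpE : Mp u v = 9 * g + t / 250 by rewrite /Mp invfM -/g -/t; ring.
have m2 : mean2 u v = 1 - p / 2 - q / 2 + t * g / 4.
  rewrite /mean2; have -> : \sum_z (1 - M u z / 2) * (1 - M v z / 2) =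
     n - (\sum_z M u z) / 2 - (\sum_z M v z) / 2 + (\sum_z M u z * M v z) / 4.
    rewrite !mulr_suml -!sumrN /n -(mulr_natr 1) -sumr_const -!big_split.
    by apply: eq_bigr => z _ /=; field.
  by rewrite /p /q /g /G2 /t; field; rewrite !gt_eqF.
rewrite /corr m2 MpE /mean1 -/p -/q; apply: corr_numeric => //.
by rewrite natrM -mulrA mulfV ?mulr1 // gt_eqF.
Qed.

End Ghosts.

(** * Clique measures with prescribed edge marginals *)

Section Cliques.
Variable G : sgraph.

Definition is_clique (S : {set G}) : bool :=
  [forall x in S, forall y in S, (x != y) ==> adj x y].

Lemma is_cliqueP (S : {set G}) :
  reflect {in S &, forall x y, x != y -> adj x y} (is_clique S).
Proof.
apply: (iffP forall_inP) => [h x y xS yS xy|h x xS].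
  by have /forall_inP/(_ y yS)/implyP := h x xS; apply.
by apply/forall_inP => y yS; apply/implyP; exact: h.
Qed.

Lemma is_cliqueU x (S : {set G}) : x \notin S ->
  is_clique (x |: S) = is_clique S && [forall y in S, adj x y].
Proof.
move=> xS; apply/is_cliqueP/andP => [h|[/is_cliqueP h /forall_inP hx] y z].
  split; first by apply/is_cliqueP => y z yS zS; apply: h; rewrite in_setU1 ?yS ?zS orbT.
  apply/forall_inP => y yS; apply: h; rewrite ?in_setU1 ?eqxx ?yS ?orbT //.
  by apply: contraNneq xS => ->.
rewrite !in_setU1 => /predU1P[->|yS] /predU1P[->|zS]; rewrite ?eqxx // => yz.
- exact: hx.
- by rewrite adj_sym hx.
- exact: h.
Qed.

Lemma clique_degree (S : {set G}) x : is_clique S -> x \in S ->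
  #|[set y in S | adj x y]| = #|S|.-1.
Proof.
move=> /is_cliqueP cS xS; rewrite (cardsD1 x S) xS /=; apply: eq_card => y.
rewrite !inE; have [->|yx] := eqVneq y x; first by rewrite adj_irr andbF.
by have [yS|//] := boolP (y \in S); rewrite cS // eq_sym.
Qed.
End Cliques.

(** * Exact marginals from a box stable under correction *)

Section GibbsFixpoint.
Context {R : realType} {G : sgraph}.
Variable r : nat.
Hypothesis r2 : (2 <= r)%N.

Definition rclique (S : {set G}) : bool := (#|S| == r) && is_clique S.

(** The double sum runs over ordered pairs, hence the division by 2. *)
Definition energy (b : G -> R) (f : G -> G -> R) (S : {set G}) : R :=
  \sum_(x in S) b x + (\sum_(x in S) \sum_(y in S | adj x y) f x y) / 2.

Definition edge_sum (W : {set G} -> R) (u v : G) : R :=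
  \sum_(S | [&& rclique S, u \in S & v \in S]) W S.

Definition pair_sum (g : G -> G -> R) : R := \sum_x \sum_(y | adj x y) g x y.

Lemma pair_sum_edge_sum W (g : G -> G -> R) :
  pair_sum (fun x y => edge_sum W x y * g x y) =
  \sum_(S | rclique S) W S * \sum_(x in S) \sum_(y in S | adj x y) g x y.
Proof.
rewrite /pair_sum /edge_sum; symmetry.
under eq_bigr => S _ do rewrite mulr_sumr.
rewrite (exchange_big_dep xpredT) //=; apply: eq_bigr => x _.
under eq_bigr => S _ do rewrite mulr_sumr.
rewrite (exchange_big_dep (fun y => adj x y)) /=; last by move=> S y _ /andP[].
apply: eq_bigr => y xy; rewrite mulr_suml; apply: eq_bigl => S.
by rewrite xy andbT -andbA.
Qed.

Lemma clique_pair_sum (S : {set G}) (d : G -> R) : rclique S ->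
  \sum_(x in S) \sum_(y in S | adj x y) d x = r.-1%:R * \sum_(x in S) d x.
Proof.
move=> /andP[/eqP Sr cS]; rewrite mulr_sumr; apply: eq_bigr => x xS.
rewrite sumr_const (_ : #|_| = r.-1) ?mulr_natl // -Sr -(clique_degree cS xS).
by apply: eq_card => y; rewrite !inE.
Qed.

Lemma exchange_in_pair (S : {set G}) (g : G -> G -> R) :
  \sum_(x in S) \sum_(y in S | adj x y) g x y =
  \sum_(x in S) \sum_(y in S | adj x y) g y x.
Proof.
rewrite (exchange_big_dep (mem S)) /=; last by move=> x y _ /andP[].
apply: eq_bigr => x xS; apply: eq_bigl => y.
by rewrite xS adj_sym.
Qed.

Lemma exchange_pair (g : G -> G -> R) : pair_sum g = pair_sum (fun x y => g y x).
Proof.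
rewrite /pair_sum (exchange_big_dep xpredT) //=.
by apply: eq_bigr => x _; apply: eq_bigl => y; rewrite adj_sym.
Qed.

Lemma pair_sumD (g1 g2 : G -> G -> R) : pair_sum (fun x y => g1 x y + g2 x y) = pair_sum g1 + pair_sum g2.
Proof. by rewrite /pair_sum -big_split; apply: eq_bigr => x _; rewrite big_split. Qed.

Lemma pair_sumZ (k : R) g : pair_sum (fun x y => k * g x y) = k * pair_sum g.
Proof. by rewrite /pair_sum mulr_sumr; apply: eq_bigr => x _; rewrite mulr_sumr. Qed.

Lemma eq_pair_sum (g1 g2 : G -> G -> R) : (forall x y, adj x y -> g1 x y = g2 x y) -> pair_sum g1 = pair_sum g2.
Proof. by move=> h; apply: eq_bigr => x _; apply: eq_bigr => y; exact: h. Qed.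

Lemma pair_sum_ge0_eq0 (g : G -> G -> R) : (forall x y, adj x y -> 0 <= g x y) -> pair_sum g <= 0 ->
  forall x y, adj x y -> g x y = 0.
Proof.
move=> g0 gs x y xy.
have h1 u : 0 <= \sum_(v | adj u v) g u v by apply: sumr_ge0 => v; exact: g0.
have := gs; rewrite /pair_sum (bigD1 x) //= (bigD1 y) //=.
have : 0 <= \sum_(u | u != x) \sum_(v | adj u v) g u v by apply: sumr_ge0.
have : 0 <= \sum_(v | adj x v && (v != y)) g x v.
  by apply: sumr_ge0 => v /andP[xv _]; exact: g0.
have := g0 _ _ xy.
by move=> *; apply/eqP; rewrite eq_le; apply/andP; split; lra.
Qed.

Lemma pair_sum_gt0 (g : G -> G -> R) (u v : G) : (forall x y : G, adj x y -> 0 < g x y) -> adj u v -> 0 < pair_sum g.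
Proof.
move=> g0 uv; rewrite lt_neqAle eq_sym; apply/andP; split; last first.
  by apply: sumr_ge0 => x _; apply: sumr_ge0 => y xy; rewrite ltW // g0.
apply: contraPneq (g0 _ _ uv) => gs.
by rewrite (pair_sum_ge0_eq0 _ _ uv) ?ltxx ?gs // => x y xy; rewrite ltW // g0.
Qed.

(** The self-map hypothesis says that the correction [(bs, fs)], which would repair all marginals if
    nothing else moved, stays in the box. At the constrained minimiser it is thus an admissible
    direction, and optimality there forces the marginals to be proportional to [T]. *)
Lemma gibbs_fixpoint (T : G -> G -> R) (lob hib : G -> R) (lof : G -> G -> R) :
  (forall x y, adj x y -> 0 < T x y) -> (forall x y, T x y = T y x) ->
  (forall x, lob x <= hib x) -> (forall x y, lof x y <= 0) ->
  (forall x y, lof x y = lof y x) ->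
  (forall b f, (forall x, lob x <= b x <= hib x) -> (forall x y, lof x y <= f x y <= 0) ->
    (forall x y, f x y = f y x) ->
    exists bs fs C, [/\ forall x, lob x <= bs x <= hib x,
      forall x y, adj x y -> lof x y <= fs x y <= 0, 0 < C,
      forall x y, adj x y -> fs x y = fs y x &
      forall x y, adj x y -> edge_sum (fun S => expR (energy b f S)) x y =
        C * T x y * expR (- ((bs x - b x) + (bs y - b y) + (fs x y - f x y)))]) ->
  exists2 W, (forall S, 0 <= W S) & forall x y, adj x y -> edge_sum W x y = T x y.
Proof.
move=> T0 TC lohi lof0 lofC self.
(* [tau] divides by [pair_sum T], so a graph without edges is treated apart. *)
have [/existsP[u0 /existsP[v0 uv0]]|/existsPn noadj] := boolP [exists u : G, exists v : G, adj u v];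
  last first.
  exists (fun=> 0) => // x y xy; have /existsPn/(_ y) := noadj x; by rewrite xy.
have rp : 0 < r.-1%:R :> R by rewrite ltr0n -ltnS prednK // ltnW.
have sT0 : 0 < pair_sum T by exact: pair_sum_gt0 T0 uv0.
(* Normalised so that [tau * T] has total mass r (r - 1), the number of ordered pairs in an
   [r]-clique; this yields [KT], so adding a constant to [l] changes nothing. *)
pose tau := r%:R * r.-1%:R / pair_sum T.
pose I : finType := (G + G * G)%type.
pose lo (i : I) := match i with inl x => lob x | inr (x, y) => lof x y end.
pose hi (i : I) := match i with inl x => hib x | inr (x, y) => 0 end.
(* The linear form [energy] minus its [tau * T] average. A vertex parameter is shared among the r -
   1 clique edges at that vertex. *)
pose c (S : {set G}) (i : I) : R := match i with
  | inl x => (x \in S)%:R - tau * (\sum_(y | adj x y) T x y) / r.-1%:R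
  | inr (x, y) => if adj x y then (([&& x \in S & y \in S])%:R - tau * T x y) / 2 else 0 end.
have cE S (p : I -> R) : \sum_i c S i * p i =
   energy (fun x => p (inl x)) (fun x y => p (inr (x, y))) S
   - tau * (pair_sum (fun x y => T x y * (p (inl x) / r.-1%:R + p (inr (x, y)) / 2))).
  have -> : \sum_i c S i * p i = \sum_x c S (inl x) * p (inl x) +
      \sum_x \sum_y c S (inr (x, y)) * p (inr (x, y)).
    rewrite big_sumType pair_bigA /=; congr (_ + _).
    by apply: eq_bigr => -[x y].
  rewrite /=.
  rewrite /energy /pair_sum mulr_sumr.
  under [X in _ = _ - X]eq_bigr => x _ do rewrite mulr_sumr.
  rewrite [X in _ = X + _ - _]big_mkcond [X in _ = _ + X / _ - _]big_mkcond /= mulr_suml.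
  rewrite -!big_split -sumrB /=; apply: eq_bigr => x _.
  have -> : \sum_y (if adj x y then (((x \in S) && (y \in S))%:R - tau * T x y) / 2 else 0) *
      p (inr (x, y)) =
    \sum_(y | adj x y) (((x \in S) && (y \in S))%:R * p (inr (x, y)) / 2) -
    \sum_(y | adj x y) (tau * T x y * (p (inr (x, y)) / 2)).
    rewrite -sumrB [RHS]big_mkcond; apply: eq_bigr => y _; case: ifP => _; last by rewrite mul0r.
    by field.
  have -> : \sum_(y | adj x y) tau * (T x y * (p (inl x) / r.-1%:R + p (inr (x, y)) / 2)) =
    tau * (\sum_(y | adj x y) T x y) / r.-1%:R * p (inl x) +
    \sum_(y | adj x y) (tau * T x y * (p (inr (x, y)) / 2)).
    rewrite mulr_sumr !mulr_suml -big_split; apply: eq_bigr => y _ /=; ring.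
  have -> : \sum_(y | adj x y) (((x \in S) && (y \in S))%:R * p (inr (x, y)) / 2) =
     (if x \in S then \sum_(y in S | adj x y) p (inr (x, y)) else 0) / 2.
    have [xS|xS] := boolP (x \in S); last by rewrite mul0r big1 // => y _; rewrite !mul0r.
    rewrite mulr_suml big_mkcondl; apply: eq_bigr => y _ /=.
    by case: (y \in S); rewrite ?mul1r ?mul0r.
  by case: (x \in S) => /=; rewrite ?mulr1n ?mulr0n; ring.
have lohi' i : lo i <= hi i by case: i => [x|[x y]] /=.
have [p pbox pvar] := box_variational rclique c lohi'.
(* The minimiser may be asymmetric in its edge parameters, but the energy and the pairing with [T]
   see only the symmetric part. *)
pose b x := p (inl x); pose f0 x y := p (inr (x, y)); pose f x y := (f0 x y + f0 y x) / 2.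
have f0box x y : lof x y <= f0 x y <= 0 by exact: (pbox (inr (x, y))).
have [| | |bs [fs [C [bsbox fsbox C0 fsC edgeE]]]] := self b f.
- by move=> x; exact: (pbox (inl x)).
- move=> x y; have /andP[] := f0box x y; have /andP[] := f0box y x; rewrite (lofC y x).
  by move=> *; rewrite /f; apply/andP; split; lra.
- by move=> x y; rewrite /f addrC.
pose d x := bs x - b x.
pose l x y := d x + d y + (fs x y - f x y).
(* Edge parameters move only 1/(r - 1) of the way: vertex moves already count r - 1 times in the sum
   of [l] over a clique, so this makes the energy change exactly [k] times that sum. *)
pose q (i : I) := match i with inl x => bs x
  | inr (x, y) => if adj x y then f0 x y + (fs x y - f0 x y) / r.-1%:R else f0 x y end.
have rp1 : r.-1%:R^-1 <= 1 :> R by rewrite invf_le1 // ler1n -ltnS prednK // ltnW.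
have qbox i : lo i <= q i <= hi i.
  case: i => [x|[x y]] /=; first exact: bsbox.
  case: ifP => [xy|_]; last exact: f0box.
  have /andP[f1 f2] := f0box x y; have /andP[g1 g2] := fsbox x y xy.
  have k0 : 0 <= r.-1%:R^-1 :> R by rewrite invr_ge0 ltW.
  have k1 : 0 <= 1 - r.-1%:R^-1 :> R by rewrite subr_ge0.
  have h1 := mulr_ge0 k0 (_ : 0 <= fs x y - lof x y).
  have h2 := mulr_ge0 k1 (_ : 0 <= f0 x y - lof x y).
  have h3 := mulr_ge0 k0 (_ : 0 <= - fs x y).
  have h4 := mulr_ge0 k1 (_ : 0 <= - f0 x y).
  have {}h1 := h1 ltac:(by rewrite subr_ge0). have {}h2 := h2 ltac:(by rewrite subr_ge0).
  have {}h3 := h3 ltac:(by rewrite oppr_ge0). have {}h4 := h4 ltac:(by rewrite oppr_ge0).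
  apply/andP; split; lra.
have sym_in (S : {set G}) : \sum_(x in S) \sum_(y in S | adj x y) f0 x y =
    \sum_(x in S) \sum_(y in S | adj x y) f x y.
  have -> : \sum_(x in S) \sum_(y in S | adj x y) f x y =
    (\sum_(x in S) \sum_(y in S | adj x y) f0 x y +
     \sum_(x in S) \sum_(y in S | adj x y) f0 y x) / 2.
    rewrite -big_split mulr_suml; apply: eq_bigr => x _ /=.
    by rewrite -big_split mulr_suml.
  by rewrite -exchange_in_pair; field.
have sym_T : pair_sum (fun x y => T x y * f0 x y) = pair_sum (fun x y => T x y * f x y).
  have -> : pair_sum (fun x y => T x y * f x y) =
     (pair_sum (fun x y => T x y * f0 x y) + pair_sum (fun x y => T y x * f0 y x)) / 2.
    rewrite -pair_sumD mulrC -pair_sumZ; apply: eq_pair_sum => x y _.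
    by rewrite (TC y x) /f; field.
  by rewrite -(exchange_pair (fun x y => T x y * f0 x y)); field.
pose W S := expR (energy b f S).
pose k : R := (2 * r.-1%:R)^-1.
have k0 : 0 < k by rewrite invr_gt0 mulr_gt0.
have rn0 : r.-1%:R != 0 :> R by rewrite gt_eqF.
have dE S : rclique S -> \sum_i c S i * (q i - p i) =
    k * (\sum_(x in S) \sum_(y in S | adj x y) l x y - tau * pair_sum (fun x y => T x y * l x y)).
  move=> Sr; rewrite (cE S (fun i => q i - p i)) /energy /=.
  rewrite -/b -/d.
  have -> : \sum_(x in S) \sum_(y in S | adj x y)
      ((if adj x y then f0 x y + (fs x y - f0 x y) / r.-1%:R else f0 x y) - p (inr (x, y))) =
    r.-1%:R^-1 * (\sum_(x in S) \sum_(y in S | adj x y) fs x y -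
       \sum_(x in S) \sum_(y in S | adj x y) f0 x y).
    rewrite -sumrB mulr_sumr; apply: eq_bigr => x _; rewrite -sumrB mulr_sumr.
    by apply: eq_bigr => y /andP[_ xy]; rewrite xy -/(f0 x y); ring.
  have -> : \sum_(x in S) \sum_(y in S | adj x y) l x y =
    2 * r.-1%:R * \sum_(x in S) d x +
     (\sum_(x in S) \sum_(y in S | adj x y) fs x y -
       \sum_(x in S) \sum_(y in S | adj x y) f0 x y).
    have e1 := clique_pair_sum d Sr.
    have e2 := exchange_in_pair S (fun x _ => d x); rewrite e1 in e2.
    rewrite (_ : 2 * r.-1%:R * _ = r.-1%:R * (\sum_(x in S) d x) +
       r.-1%:R * (\sum_(x in S) d x)); last by ring.
    rewrite -{1}e1 e2 sym_in -sumrB -!big_split; apply: eq_bigr => x _ /=.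
    by rewrite -sumrB -!big_split.
  have -> : pair_sum (fun x y => T x y * (d x / r.-1%:R +
     ((if adj x y then f0 x y + (fs x y - f0 x y) / r.-1%:R else f0 x y) - p (inr (x, y))) / 2)) =
     k * pair_sum (fun x y => T x y * l x y).
    have -> : pair_sum (fun x y => T x y * l x y) =
       2 * pair_sum (fun x y => T x y * d x) + pair_sum (fun x y => T x y * fs x y)
        - pair_sum (fun x y => T x y * f0 x y).
      rewrite sym_T (_ : 2 * _ = pair_sum (fun x y => T x y * d x) + pair_sum (fun x y => T y x * d y));
        last by rewrite -(exchange_pair (fun x y => T x y * d x)); ring.
      rewrite -mulN1r -pair_sumZ -!pair_sumD; apply: eq_pair_sum => x y _; rewrite (TC y x) /l; ring.
    rewrite -!pair_sumZ -mulN1r -!pair_sumZ -!pair_sumD -?pair_sumZ.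
    by apply: eq_pair_sum => x y xy; rewrite xy -/(f0 x y) /k; field.
  by rewrite /k; field.
pose Z := \sum_(S | rclique S) W S.
pose K := Z * tau.
have var : 0 <= pair_sum (fun x y => edge_sum W x y * l x y) - K * pair_sum (fun x y => T x y * l x y).
  have := pvar q qbox; set L := tau * pair_sum (fun x y => T x y * (b x / r.-1%:R + f0 x y / 2)).
  have -> : \sum_(S | rclique S) expR (\sum_i c S i * p i) * (\sum_i c S i * (q i - p i)) =
     expR (- L) * k * (pair_sum (fun x y => edge_sum W x y * l x y)
       - K * pair_sum (fun x y => T x y * l x y)).
    have -> : K * pair_sum (fun x y => T x y * l x y) =
       \sum_(S | rclique S) W S * (tau * pair_sum (fun x y => T x y * l x y)).
      by rewrite /K /Z -mulrA mulr_suml.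
    rewrite pair_sum_edge_sum -sumrB mulr_sumr; apply: eq_bigr => S Sr.
    rewrite cE -/L expRD -/b dE //.
    have -> : energy b (fun x y => p (inr (x, y))) S = energy b f S.
      by rewrite /energy -sym_in.
    by rewrite -/(W S); ring.
  by rewrite pmulr_rge0 // mulr_gt0 // expR_gt0.
have r0 : 0 < r%:R :> R by rewrite ltr0n ltnW.
have KT : pair_sum (edge_sum W) = K * pair_sum T.
  have -> : pair_sum (edge_sum W) = pair_sum (fun x y => edge_sum W x y * 1).
    by apply: eq_pair_sum => x y _; rewrite mulr1.
  rewrite pair_sum_edge_sum.
  have -> : K * pair_sum T = Z * (r.-1%:R * r%:R).
    by rewrite /K /tau; field; rewrite gt_eqF.
  rewrite mulr_suml; apply: eq_bigr => S Sr; rewrite (clique_pair_sum (fun=> 1) Sr).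
  by rewrite sumr_const; case/andP: Sr => /eqP ->.
have eE x y : adj x y -> edge_sum W x y = C * T x y * expR (- l x y) by exact: edgeE.
have K0 : 0 < K.
  rewrite -(pmulr_lgt0 _ sT0) -KT; apply: pair_sum_gt0 uv0 => x y xy.
  by rewrite eE // !mulr_gt0 ?expR_gt0 ?T0.
(* The value of [l] at which C exp(-l) = K. Both factors [K - C * expR (- l x y)] and [l x y - l0]
   change sign there, so each summand in [gE] is nonnegative; by [KT] and [var] their sum is at most
   0, so all vanish. *)
pose l0 := ln (C / K).
have el0 : expR l0 = C / K by rewrite /l0 lnK // posrE divr_gt0.
have gE x y : adj x y -> T x y * ((K - C * expR (- l x y)) * (l x y - l0)) = 0.
  apply: (@pair_sum_ge0_eq0 (fun x y => T x y * ((K - C * expR (- l x y)) * (l x y - l0)))).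
    move=> u v uv; rewrite mulr_ge0 ?(ltW (T0 _ _ uv)) //.
    have -> : C * expR (- l u v) = K * expR (l0 - l u v).
      by rewrite expRD el0; field; rewrite gt_eqF.
    rewrite -{1}(mulr1 K) -mulrBr -mulrA mulr_ge0 ?(ltW K0) //.
    have [h|h] := lerP l0 (l u v).
      by rewrite mulr_ge0 ?subr_ge0 // -expR0 ler_expR subr_le0.
    by rewrite mulr_le0 ?subr_le0 ?(ltW h) // -expR0 ler_expR subr_ge0 ltW.
  have -> : pair_sum (fun x y => T x y * ((K - C * expR (- l x y)) * (l x y - l0))) =
     K * pair_sum (fun x y => T x y * l x y) + -1 * pair_sum (fun x y => edge_sum W x y * l x y)
     + l0 * pair_sum (edge_sum W) + - (l0 * K) * pair_sum T.
    rewrite -!pair_sumZ -!pair_sumD.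
    by apply: eq_pair_sum => u v uv; rewrite eE //; ring.
  by rewrite KT; lra.
exists (fun S => W S / K) => [S|x y xy]; first by rewrite divr_ge0 ?expR_ge0 ?(ltW K0).
have -> : edge_sum (fun S => W S / K) x y = edge_sum W x y / K by rewrite /edge_sum mulr_suml.
rewrite eE //.
have CK : C * expR (- l x y) = K.
  have /eqP := gE x y xy; rewrite !mulf_eq0 gt_eqF ?T0 //= => /orP[|].
    by rewrite subr_eq0 => /eqP.
  rewrite subr_eq0 => /eqP ->; rewrite expRN el0 invf_div; field; by rewrite gt_eqF.
by rewrite (mulrAC C) CK mulrC mulKf ?gt_eqF.
Qed.

End GibbsFixpoint.

(** * Edge marginals of Gibbs measures as partition functions *)

Section EdgeSum.
Context {R : realType} {G : sgraph}.
Variables (b : G -> R) (f : G -> G -> R).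
Hypothesis fC : forall x y, f x y = f y x.

(** Non-adjacent or equal vertices repel with a hard core, so that only cliques carry weight. *)
Definition edge_factor (x y : G) : R := if adj x y then expR (f x y) else 0.

Definition clique_factor (S : {set G}) : R :=
  if is_clique S then expR ((\sum_(x in S) \sum_(y in S | adj x y) f x y) / 2) else 0.

Lemma clique_factorU x (S : {set G}) : x \notin S ->
  clique_factor (x |: S) = clique_factor S * \prod_(y in S) edge_factor x y.
Proof.
move=> xS; rewrite /clique_factor is_cliqueU //.
case: (is_clique S); last by rewrite /= mul0r.
have [/forall_inP hx|] /= := boolP [forall y in S, adj x y]; last first.
  case/forall_inPn => y yS nxy.
  by rewrite [X in _ * X](bigD1 y) //= /edge_factor (negPf nxy) mul0r mulr0.
have -> : \prod_(y in S) edge_factor x y = expR (\sum_(y in S) f x y).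
  rewrite expR_sum; apply: eq_bigr => y yS; by rewrite /edge_factor hx.
rewrite -expRD; congr expR.
have inner z : \sum_(y in x |: S | adj z y) f z y =
   (if adj z x then f z x else 0) + \sum_(y in S | adj z y) f z y.
  by rewrite big_mkcondr big_setU1 //= -big_mkcondr.
rewrite big_setU1 //= inner adj_irr add0r.
under [X in _ + X]eq_bigr => z zS do rewrite inner adj_sym (hx z zS) fC.
have -> : \sum_(y in S | adj x y) f x y = \sum_(y in S) f x y.
  by apply: eq_bigl => y; have [/hx ->|] := boolP (y \in S).
by rewrite big_split /=; field.
Qed.

Lemma edge_sum_Zpart r u v : adj u v ->
  edge_sum r.+2 (fun S => expR (energy b f S)) u v =
  expR (b u) * expR (b v) * expR (f u v) / r`!%:R *
  Zpart edge_factor r (tilt edge_factor (tilt edge_factor (fun x => expR (b x)) u) v).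
Proof.
move=> uv.
have uv' : u != v by apply: contraTneq uv => ->; rewrite adj_irr.
have xx x : edge_factor x x = 0 by rewrite /edge_factor adj_irr.
have c0 : clique_factor set0 = 1.
  rewrite /clique_factor big_set0 mul0r expR0 ifT //.
  by apply/is_cliqueP => x y; rewrite in_set0.
rewrite (Zpart_set_sum xx c0 clique_factorU) mulrA divfK ?pnatr_eq0 -?lt0n ?fact_gt0 //.
have := sum_set_weight_pair xx clique_factorU r (fun x => expR (b x)) uv'.
have -> : edge_factor u v = expR (f u v) by rewrite /edge_factor uv.
rewrite mulrA => <-.
rewrite /edge_sum [RHS](bigID (@is_clique G)) /= [X in _ = _ + X]big1 ?addr0; last first.
  by move=> S /andP[_ /negPf nc]; rewrite /set_weight /clique_factor nc mulr0.
apply: eq_big => [S|S /and3P[/andP[_ cS] _ _]].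
  by rewrite /rclique; case: (#|S| == _); case: (is_clique S); rewrite ?andbF ?andbT //= andbT.
by rewrite /set_weight /clique_factor cS -expR_sum -expRD.
Qed.

End EdgeSum.

(** * Solving for the targets of a fixed ghost tuple *)

Section GhostDecomposition.
Context {R : realType} {G : sgraph}.
Variables (r : nat) (M : G -> G -> R).
Let n : R := #|G|%:R.
Hypothesis r4 : (4 <= r)%N.
Hypothesis n0 : 0 < n.
Hypothesis Minv : majorant_inv r M.
Hypothesis Mfix : forall x y, M x y = maj_step (fun x y : G => (~~ adj x y)%:R) r M x y.

Let G2 u v : R := r%:R / n * \sum_z M u z * M v z.
Let Mp u v : R := 9 * G2 u v + (250 * r%:R)^-1.

Let r0 : 0 < r%:R :> R. Proof. by rewrite ltr0n; case: r r4. Qed.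
Let t : R := r%:R^-1.
Let t0 : 0 < t. Proof. by rewrite invr_gt0. Qed.
Let t1 : t <= 1 / 4. Proof. by rewrite mul1r lef_pV2 ?posrE // ler_nat. Qed.
Let cstar : R := 1 - 11 / 50 / 100 * t.

Lemma ghost_decomposition (w : ghost (V := G) r) :
  exists2 W : {set G} -> R, (forall S, 0 <= W S) &
    forall x y, adj x y -> edge_sum r W x y =
      ghost_field M w x * ghost_field M w y / mean2 M x y ^+ (12 * r).
Proof.
have [M01 MC Mrow] := Minv.
have G2b u v : 0 <= G2 u v <= 1 / 50 by exact: majorant_inv_corr.
have M0 x y : 0 <= M x y by have /andP[] := M01 x y.
have MpM x y : Mp x y <= M x y by rewrite [leRHS]Mfix /maj_step -addrA lerDr.
(* This makes the hard core factor 0 admissible: it needs 1 - 0 <= [M x y]. *)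
have Mna x y : ~~ adj x y -> 1 <= M x y.
  move=> nxy; rewrite Mfix /maj_step nxy -addrA lerDl; apply: le_trans (_ : _ <= Mp x y) _ => //.
  rewrite /Mp invfM; have /andP[] := G2b x y; have := t0; rewrite /t; lra.
have cb u v := corr_bounds r4 n0 M01 Mrow G2b u v.
have nb u := norm1_bounds r4 n0 M01 Mrow u.
have Mp0 u v : 0 <= Mp u v <= 181 / 1000.
  rewrite /Mp invfM -/t; have /andP[] := G2b u v; have := t0; have := t1.
  by move=> *; apply/andP; split; lra.
have n1 u : 0 < norm1 M r u by have /andP[] := nb u; lra.
have f1 u : 0 < ghost_field M w u by exact: ghost_field_gt0.
(* The field normalised to mean 1. As [norm1] lies in [9/10, 1], [sigma] is at most 10/9 and at
   least the field, whose sum is at least 9n/10: the two halves of [spread]. *)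
pose sigma u := ghost_field M w u / norm1 M r u.
have s0 u : 0 < sigma u by rewrite divr_gt0.
have s1 u : sigma u <= 10 / 9.
  rewrite ler_pdivrMr //; have := ghost_field_le1 M01 w u; have /andP[] := nb u; lra.
have s2 u : ghost_field M w u <= sigma u.
  by rewrite ler_pdivlMr // ler_piMr ?(ltW (f1 u)) //; have /andP[] := nb u.
have cs0 : 0 < cstar by rewrite /cstar; have := t0; have := t1; lra.
have corr0 u v : 0 < corr M r u v.
  have [c1 _] := cb u v; have /andP[m0 m1] := Mp0 u v.
  have := lt_le_trans cs0 c1; rewrite pmulr_lgt0 //; rewrite -/(Mp u v); lra.
have corrC u v : corr M r u v = corr M r v u.
  rewrite /corr (mulrC (mean1 M u)); congr ((_ / _) ^+ _).
  by rewrite /mean2; congr (_ / _); apply: eq_bigr => z _; rewrite mulrC.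
have TE x y : ghost_field M w x * ghost_field M w y / mean2 M x y ^+ (12 * r) =
    sigma x * sigma y / corr M r x y.
  have : corr M r x y != 0 by rewrite gt_eqF.
  have -> : corr M r x y = mean2 M x y ^+ (12 * r) / (norm1 M r x * norm1 M r y).
    by rewrite /corr /norm1 -exprMn -expr_div_n.
  rewrite mulf_eq0 negb_or /sigma; move: (mean2 M x y ^+ _) => m /andP[m2 _].
  by field; rewrite m2 !gt_eqF.
have r2 : (2 <= r)%N by exact: leq_trans r4.
(* The vertex box has width ln(45/44) since conditioning on one vertex multiplies the partition
   function by a factor in [44/45, 1]. *)
have [||||||W W0 WE] := @gibbs_fixpoint R G r r2 (fun x y => sigma x * sigma y / corr M r x y)
  (fun x => ln (sigma x)) (fun x => ln (sigma x) + ln (45 / 44)) (fun x y => - M x y).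
- by move=> x y _; exact: divr_gt0 (mulr_gt0 (s0 x) (s0 y)) (corr0 x y).
- by move=> x y; rewrite corrC (mulrC (sigma x)).
- by move=> x; rewrite lerDl ln_ge0 //; lra.
- by move=> x y; rewrite oppr_le0.
- by move=> x y; rewrite MC.
- move=> b f bbox fbox fC.
  pose phi := edge_factor f.
  pose h x := expR (b x).
  have phi0 x y : 0 <= phi x y by rewrite /phi /edge_factor; case: ifP => _ //; exact: expR_ge0.
  have phi1 x y : phi x y <= 1.
    rewrite /phi /edge_factor; case: ifP => _ //; have /andP[_] := fbox x y.
    by rewrite -ler_expR expR0.
  have phiM x y : 1 - phi x y <= M x y.
    rewrite /phi /edge_factor; case: ifP => [_|/negbT nxy]; last by rewrite subr0 Mna.
    by have /andP[f2 _] := fbox x y; have := expR_ge1Dx (f x y); lra.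
  have hh : spread r 0 h.
    split.
      move=> x; rewrite expR_ge0 /=; have /andP[_ b2] := bbox x.
      apply: le_trans (_ : expR (ln (sigma x) + ln (45 / 44)) <= _); first by rewrite ler_expR.
      have e45 : 0 < 45 / 44 :> R by lra.
      rewrite expRD !lnK ?posrE //.
      have := s1 x; lra.
    rewrite mul0r subr0; apply: le_trans (sum_ghost_field_ge r4 M01 MC Mrow w) _.
    apply: ler_sum => x _; apply: le_trans (s2 x) _; have /andP[b1 _] := bbox x.
    by rewrite -ler_expR lnK ?posrE // in b1.
  (* Two clique vertices are the ends of the edge; [k] counts the others. *)
  have [k rE] : exists k, r = k.+2 by case: (r) r4 => [|[|k]] // _; exists k.
  have k2r : (0 + k + 2 <= r)%N by rewrite rE addn2.
  have kr : (0 + k <= r)%N by rewrite rE; apply: leqW; apply: leqW.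
  pose Zk := Zpart phi k.
  have Z0 : 0 < Zk h by exact: (Zpart_gt0 r4 n0 M0 Mrow phi0 phi1 phiM hh kr).
  have Zlo u : 44 / 45 * Zk h <= Zk (tilt phi h u).
    exact: (Zpart_tilt_ge r4 n0 M0 Mrow phi0 phi1 phiM u hh kr).
  have Zhi u : Zk (tilt phi h u) <= Zk h.
    by apply: Zpart_tilt_le => // x; exact: expR_ge0.
  have Zu u : 0 < Zk (tilt phi h u) by have := Zlo u; lra.
  pose Ru u := Zk (tilt phi h u) / Zk h.
  have Ru0 u : 0 < Ru u by rewrite divr_gt0.
  have Ru1 u : Ru u <= 1 by rewrite ler_pdivrMr // mul1r.
  have Ru2 u : 44 / 45 <= Ru u by rewrite ler_pdivlMr.
  pose Q u v := Zk (tilt phi (tilt phi h u) v) * Zk h / (Zk (tilt phi h u) * Zk (tilt phi h v)).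
  have Qb u v : 1 - 3 / 10 * Mp u v <= Q u v <= 1 + 3 / 10 * Mp u v.
    have G2le x y : G2 x y <= 1 / 50 by have /andP[] := G2b x y.
    have /andP[q1 q2] := Zpart_corr r4 n0 M0 Mrow phi0 phi1 phiM MpM G2le u v hh k2r.
    have [p1 p2] := corr_pow r4 n0 M0 G2le u v kr.
    have ZZ := mulr_gt0 (Zu u) (Zu v).
    apply/andP; split.
      by rewrite ler_pdivlMr //; apply: le_trans q1; apply: ler_wpM2r p1; exact: ltW.
    by rewrite ler_pdivrMr //; apply: (le_trans q2); apply: ler_wpM2r p2; exact: ltW.
  have Q0 u v : 0 < Q u v.
    by have /andP[q1 _] := Qb u v; have /andP[m1 m2] := Mp0 u v; apply: lt_le_trans q1; lra.
  (* The marginal is e^(b x + b y + f x y) [Ru x] [Ru y] [Q x y] up to a constant, so these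
     parameters cancel [Ru] and [Q] and leave the target. The slack [cstar] goes into the edge part,
     where both halves of [corr_bounds] are stated against it. *)
  exists (fun u => ln (sigma u) - ln (Ru u)).
  exists (fun u v => ln cstar - ln (corr M r u v) - ln (Q u v)).
  exists (cstar * Zk h / k`!%:R); split.
  + move=> x; apply/andP; split; first by rewrite lerBrDr gerDl ln_le0.
    rewrite lerD2l lerNl -lnV ?posrE; last by lra.
    by rewrite ler_ln ?posrE //; have := Ru2 x; lra.
  + move=> x y _; have [c1 c2] := cb x y; have /andP[q1 q2] := Qb x y.
    have cQ : 0 < corr M r x y * Q x y by rewrite mulr_gt0.
    have -> : ln cstar - ln (corr M r x y) - ln (Q x y) = ln (cstar / (corr M r x y * Q x y)).
      by rewrite ln_div ?posrE // lnM ?posrE // opprD addrA.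
    apply/andP; split.
      rewrite -ler_expR lnK ?posrE ?divr_gt0 // ler_pdivlMr //.
      apply: le_trans c2; rewrite mulrC; apply: ler_pM.
      * exact: ltW.
      * exact: expR_ge0.
      * by rewrite ler_wpM2l // ltW.
      * by rewrite ler_expR lerN2; exact: MpM.
    rewrite ln_le0 // ler_pdivrMr // mul1r; apply: le_trans c1 _.
    by rewrite ler_wpM2l // ltW.
  + by rewrite divr_gt0 ?mulr_gt0 // ltr0n fact_gt0.
  + move=> x y _; rewrite corrC /Q /Zk Zpart_tiltC.
    by rewrite (mulrC (Zpart _ _ (tilt phi h x)) (Zpart _ _ (tilt phi h y))).
  move=> x y xy; rewrite {1}rE edge_sum_Zpart // -/phi -/h -/Zk.
  have -> : - (ln (sigma x) - ln (Ru x) - b x + (ln (sigma y) - ln (Ru y) - b y) +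
     (ln cstar - ln (corr M r x y) - ln (Q x y) - f x y)) =
     b x + b y + f x y + ln (Ru x) - ln (sigma x)
     + ln (Ru y) - ln (sigma y) - ln cstar + ln (corr M r x y) + ln (Q x y) by ring.
  rewrite !expRD !expRN !lnK ?posrE // /Q /Ru.
  have kf : k`!%:R != 0 :> R by rewrite pnatr_eq0 -lt0n fact_gt0.
  move: (Zu x) (Zu y) Z0 (s0 x) (s0 y) (corr0 x y) cs0.
  move: (Zk (tilt phi h x)) (Zk (tilt phi h y)) (Zk h) (sigma x) (sigma y) (corr M r x y) cstar.
  move=> z1 z2 z3 z4 z5 z6 z7 *; field.
  by rewrite kf !gt_eqF.
exists W => // x y xy; by rewrite WE // TE.
Qed.
End GhostDecomposition.

(** * Fractional decompositions *)

(** Average of the solutions over all n^(12 r) ghost tuples: by [sum_ghost_field2] the mean of the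
    numerators of the targets is exactly their common denominator. *)
Lemma uniform_edge_sum (R : realType) (G : sgraph) (r : nat) :
  (4 <= r)%N -> 0 < #|G|%:R :> R ->
  (forall x : G, \sum_y (~~ adj x y)%:R <= #|G|%:R / (100 * r%:R) :> R) ->
  exists2 W : {set G} -> R, (forall S, 0 <= W S) &
    forall x y, adj x y -> edge_sum r W x y = 1.
Proof.
move=> r4 n0 row.
have [||M Minv Mfix] := majorant_exists r4 n0 _ _ row.
- by move=> x y; case: (adj x y) => /=; rewrite ?lexx ?ler01.
- by move=> x y; rewrite adj_sym.
have [M01 MC Mrow] := Minv.
have /choice[W WP] : forall w : ghost (V := G) r, exists W : {set G} -> R,
    (forall S, 0 <= W S) /\ forall x y, adj x y -> edge_sum r W x y =
      ghost_field M w x * ghost_field M w y / mean2 M x y ^+ (12 * r).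
  by move=> w; have [W W0 WE] := ghost_decomposition r4 n0 Minv Mfix w; exists W.
pose N : R := #|G|%:R ^+ (12 * r).
have N0 : 0 < N by rewrite exprn_gt0.
exists (fun S => (\sum_w W w S) / N) => [S|x y xy].
  by rewrite divr_ge0 ?(ltW N0) // sumr_ge0 // => w _; have [] := WP w.
rewrite /edge_sum -mulr_suml exchange_big /=.
under eq_bigr => w _.
  have [_ /(_ x y xy)] := WP w; rewrite /edge_sum => ->; over.
rewrite -mulr_suml sum_ghost_field2 // exprMn -/N.
have m0 : 0 < mean2 M x y.
  rewrite divr_gt0 // (eq_bigr (fun z => (1 - M x z / 2) * (1 - M y z / 2))) //.
  have pos u z : 0 < 1 - M u z / 2 by have /andP[] := M01 u z; lra.
  rewrite (bigD1 x) //=; apply: ltr_wpDr; last by rewrite mulr_gt0.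
  by apply: sumr_ge0 => z _; rewrite mulr_ge0 ?ltW.
by rewrite mulfK ?divff ?gt_eqF // exprn_gt0.
Qed.

(** * Copies of the complete graph as cliques *)

Section Copies.
Variables (G : sgraph) (r : nat).

Definition pairs_of (S : {set G}) : {set {set G}} :=
  [set [set p.1; p.2] | p in [set p : G * G | [&& p.1 \in S, p.2 \in S & p.1 != p.2]]].

Lemma mem_edges (x y : G) : ([set x; y] \in edges G) = adj x y.
Proof.
apply/imsetP/idP => [[[u v] /=]|xy]; last by exists (x, y); rewrite ?inE.
rewrite inE /= => uv e.
have uv' : u != v by apply: contraTneq uv => ->; rewrite adj_irr.
have : u \in [set x; y] by rewrite e !inE eqxx.
have : v \in [set x; y] by rewrite e !inE eqxx orbT.
rewrite !inE => /orP[/eqP vE|/eqP vE] /orP[/eqP uE|/eqP uE]; subst u v => //.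
- by rewrite eqxx in uv'.
- by rewrite adj_sym.
- by rewrite eqxx in uv'.
Qed.

Lemma mem_pairs_of (S : {set G}) (x y : G) : x != y ->
  ([set x; y] \in pairs_of S) = (x \in S) && (y \in S).
Proof.
move=> xy; apply/imsetP/andP => [[[u v] /=]|[xS yS]]; last first.
  by exists (x, y); rewrite ?inE //= xS yS.
rewrite inE /= => /and3P[uS vS _] e.
have sub z : z \in [set x; y] -> z \in S by rewrite e !inE => /orP[] /eqP ->.
by split; apply: sub; rewrite !inE eqxx ?orbT.
Qed.

(** A copy of a complete graph is determined by its vertex set, so a weight on cliques is a weight
    on copies. *)
Lemma mem_copies (H : pregraph G) :
  (H \in copies (complete_graph r) G) = rclique r H.1 && (H.2 == pairs_of H.1).
Proof.
case: H => S E; rewrite inE /=; apply/andP/andP.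
  move=> [/andP[/= sub /forall_inP inS]] /existsP[f /and3P[/injectiveP injf /eqP /= fS /forallP fE]].
  have adjE i j : i != j -> [set f i; f j] \in E.
    by move=> ij; have /forallP/(_ j)/eqP := fE i; rewrite /= /complete_adj ij => <-.
  have SP x : x \in S -> exists i, x = f i.
    by rewrite -fS => /imsetP[i _ ->]; exists i.
  have pE x y : x \in S -> y \in S -> x != y -> [set x; y] \in E.
    move=> /SP[i ->] /SP[j ->] ij; apply: adjE; by apply: contra_neq ij => ->.
  split.
    apply/andP; split; first by rewrite -fS card_imset // cardsT card_ord.
    apply/is_cliqueP => x y xS yS xy; rewrite -mem_edges.
    by apply: (fintype.subsetP sub); exact: pE.
  apply/eqP/setP => e; apply/idP/idP => [eE|/imsetP[[u v]]]; last first.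
    by rewrite inE /= => /and3P[uS vS uv] ->; exact: pE.
  have /imsetP[[u v]] := fintype.subsetP sub _ eE; rewrite inE /= => uv eq.
  have uv' : u != v by apply: contraTneq uv => ->; rewrite adj_irr.
  have eS := fintype.subsetP (inS _ eE).
  by rewrite eq mem_pairs_of // !eS // eq !inE eqxx ?orbT.
move=> [/andP[/eqP Sr cS] /eqP /= ->]; have /is_cliqueP cl := cS; split.
  apply/andP; split.
    apply/fintype.subsetP => e /imsetP[[u v]]; rewrite inE /= => /and3P[uS vS uv] ->.
    by rewrite mem_edges cl.
  apply/forall_inP => e /imsetP[[u v]]; rewrite inE /= => /and3P[uS vS uv] ->.
  by apply/fintype.subsetP => z; rewrite !inE => /orP[] /eqP ->.
apply/existsP; exists [ffun i => enum_val (cast_ord (esym Sr) i)].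
have inj : injective [ffun i : 'I_r => enum_val (cast_ord (esym Sr) i) : G].
  by move=> i j; rewrite !ffunE => /enum_val_inj /cast_ord_inj.
apply/and3P; split.
- exact/injectiveP.
- rewrite /= eqEcard; apply/andP; split; last by rewrite card_imset // cardsT card_ord Sr.
  apply/fintype.subsetP => _ /imsetP[i _ ->]; rewrite ffunE; exact: enum_valP.
- apply/forallP => i; apply/forallP => j; apply/eqP; rewrite /= /complete_adj.
  (* For equal indices the pair collapses to a singleton, which is not an edge. *)
  have [<-|ij] := eqVneq i j.
    apply/esym/negbTE/imsetP => -[[u v]]; rewrite inE /= => /and3P[_ _ uv] e.
    have : u \in [set u; v] by rewrite !inE eqxx.
    have : v \in [set u; v] by rewrite !inE eqxx orbT.
    by rewrite -e !inE !orbb => /eqP vE /eqP uE; rewrite uE vE eqxx in uv.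
  by rewrite mem_pairs_of ?(inj_eq inj) // !ffunE !enum_valP.
Qed.

Lemma sum_copies (R : realType) (W : {set G} -> R) (x y : G) : adj x y ->
  \sum_(H in copies (complete_graph r) G | [set x; y] \in H.2) W H.1 = edge_sum r W x y.
Proof.
move=> xy; have xy' : x != y by apply: contraTneq xy => ->; rewrite adj_irr.
rewrite /edge_sum (reindex_onto (fun S => (S, pairs_of S) : pregraph G) (fun H => H.1)) /=; last first.
  by move=> [S E]; rewrite mem_copies /= => /andP[/andP[_ /eqP ->] _].
by apply: eq_bigl => S; rewrite mem_copies /= !eqxx !andbT mem_pairs_of.
Qed.

End Copies.

Lemma min_degree_le (G : sgraph) (x : G) : (min_degree G <= degree x)%N.
Proof.
rewrite /min_degree; have : x \in index_enum G by exact: mem_index_enum.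
elim: index_enum => // y s IH; rewrite in_cons big_cons => /predU1P[->|/IH]; first exact: geq_minl.
by apply: leq_trans; exact: geq_minr.
Qed.

Theorem theorem1p3 (R : realType) (r : nat) (hr : (4 <= r)%N) (G : sgraph)
    (hG : (1 - 1 / (100 * r%:R)) * #|G|%:R <= (min_degree G)%:R :> R) :
  fractional_decomposition R (complete_graph r) G.
Proof.
have edgeP e : e \in edges G -> exists x y : G, adj x y /\ e = [set x; y].
  by case/imsetP => -[x y]; rewrite inE /= => xy ->; exists x, y.
(* The estimates divide by the number of vertices. *)
have [n0|n0] := posnP #|G|.
  exists (fun=> 0); split => [H _|e /edgeP[x]]; first by rewrite lexx ler01.
  by have := card0_eq n0 x.
have n0R : 0 < #|G|%:R :> R by rewrite ltr0n.
have r0 : 0 < r%:R :> R by rewrite ltr0n; apply: leq_trans hr.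
have [|W W0 W1] := uniform_edge_sum hr n0R.
  move=> x; have dx : (min_degree G)%:R <= (degree x)%:R :> R by rewrite ler_nat min_degree_le.
  (* The non-neighbours of [x] include [x] itself, so no correction by 1 occurs. *)
  have -> : \sum_y (~~ adj x y)%:R = #|G|%:R - (degree x)%:R :> R.
    have -> : (degree x)%:R = \sum_y (adj x y)%:R :> R.
      rewrite /degree -sum1_card natr_sum big_mkcond; apply: eq_bigr => y _.
      by rewrite inE; case: (adj x y).
    have -> : #|G|%:R = \sum_(y : G) 1 :> R by rewrite sumr_const.
    by rewrite -sumrB; apply: eq_bigr => y _; case: (adj x y); rewrite ?subrr ?subr0.
  have -> : #|G|%:R / (100 * r%:R) = #|G|%:R - (1 - 1 / (100 * r%:R)) * #|G|%:R :> R.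
    by field; rewrite gt_eqF.
  by rewrite lerD2l lerN2 (le_trans hG).
exists (fun H => W H.1); split=> [H HC|e /edgeP[x [y [xy ->]]]]; last by rewrite sum_copies // W1.
rewrite W0 /=; move: HC; rewrite mem_copies => /andP[/andP[/eqP Sr /is_cliqueP cS] HE].
(* For the bound by 1: the weight of a clique is one nonnegative term of the sum, equal to 1, at any
   of its edges. *)
have /card_gt1P[x [y [xS yS xy]]] : (1 < #|H.1|)%N by rewrite Sr; apply: leq_trans hr.
have axy := cS x y xS yS xy.
rewrite -(W1 x y axy) /edge_sum (bigD1 H.1) /=; last first.
  by rewrite /rclique Sr eqxx xS yS !andbT; apply/is_cliqueP.
by rewrite lerDl sumr_ge0.
Qed.
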